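(* Let $\overline{\ell}$ be an algebraically closed field of characteristic $0$ and let $\mathcal{S}_G$ be a graph of separable $\overline{\ell}$-algebras over a finite connected graph $G$, with one-quiver $Q_1(\mathcal{S}_G)$ on vertices corresponding to the dimension vectors $\alpha_1,\dots,\alpha_k$. Let $\alpha=c_1\alpha_1+\cdots+c_k\alpha_k$ be a component such that $rep_\alpha\,\pi_1(\mathcal{S}_G)$ contains simple representations. Let $S_i\in rep_{\alpha_i}\,\pi_1(\mathcal{S}_G)$, $1\le i\le k$, be simple representations and let $M\in rep_\alpha Q_0(\mathcal{S}_G)$ be the point determined by the semi-simple representation $S_1^{\oplus c_1}\oplus\cdots\oplus S_k^{\oplus c_k}$ of $\pi_1(\mathcal{S}_G)$. In the affine space $rep_\alpha Q_0(\mathcal{S}_G)$ identify the normal space to the $GL(\alpha)$-orbit $\mathcal{O}(M)$ with $$N_M=\{M+V~|~V\in rep_\gamma Q_1(\mathcal{S}_G)\},$$ where $\gamma=(c_1,\dots,c_k)$. Then $GL(\alpha).N_M$ contains a (non-empty) Zariski open subset of all $\alpha$-dimensional simple representations of $\pi_1(\mathcal{S}_G)$.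
   Context: A graph of separable algebras $\mathcal{S}_G$ over a finite connected graph $G=(V,E)$ assigns to each vertex $v$ a separable (= semi-simple finite dimensional) $\overline{\ell}$-algebra $S_v$, to each edge $e$ a separable $\overline{\ell}$-algebra $S_e$, and to each edge $e$ with ends $v,w$ embeddings $S_e\hookrightarrow S_v$, $S_e\hookrightarrow S_w$. Fix an orientation of all edges and a maximal subtree $T$. The fundamental algebra $\pi_1(\mathcal{S}_G)$ is obtained by first forming the iterated amalgamated product of the $S_v$ over the $S_e$, $e\in T$, and then, for each edge $e:v\to w$ not in $T$, performing the HNN-construction $A\mapsto A\ast\overline{\ell}[t_e,t_e^{-1}]/(\beta(s)-t_e^{-1}\alpha(s)t_e : s\in S_e)$, where $\alpha$ (resp. $\beta$) is the embedding of $S_e$ via $S_v$ (resp. $S_w$). Write $S_v=\bigoplus_{i=1}^{n_v}M_{d_v(i)}(\overline{\ell})$ with simple modules $V_i^{(v)}$ of dimension $d_v(i)$, and $S_e=\bigoplus_{k=1}^{n_e}M_{d_e(k)}(\overline{\ell})$. For an edge $e:v\to w$ let $a^{(ev)}_{ki}$ (resp. $a^{(ew)}_{kj}$) be the multiplicity of the $k$-th simple $S_e$-module in the restriction of $V_i^{(v)}$ (resp. $V_j^{(w)}$), and put $n^{(e)}_{ij}=\sum_k a^{(ev)}_{ki}a^{(ew)}_{kj}=\dim\mathrm{Hom}_{S_e}(V_i^{(v)},V_j^{(w)})$. The Zariski quiver $Q_0(\mathcal{S}_G)$ has vertices $\mu_i^{(v)}$ ($v\in V$, $1\le i\le n_v$)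 and, for each edge $e:v\to w$, exactly $n^{(e)}_{ij}$ arrows from $\mu_i^{(v)}$ to $\mu_j^{(w)}$. $rep_\alpha Q_0(\mathcal{S}_G)$ is the affine space of representations of dimension vector $\alpha=(\alpha_i^{(v)})$, with base-change action of $GL(\alpha)=\prod_{v,i}GL(\alpha_i^{(v)})$. $\alpha$ is an $n$-dimension vector if $\sum_{i}d_v(i)\alpha_i^{(v)}=n$ for all $v\in V$. For an edge $e:v\to w$, $Q_e$ is the bipartite subquiver on the $\mu_i^{(v)}$ and $\mu_j^{(w)}$ with the $n_{ij}^{(e)}$ arrows coming from $e$ (for a loop, two copies of the vertices are used). A representation $M$ whose dimension vector is an $n$-dimension vector is $\mathcal{S}_G$-semistable if for all edges $e:v\to w$ and all subrepresentations of $M|Q_e$ of dimension vector $(n_1,\dots,n_{n_v},n'_1,\dots,n'_{n_w})$ we have $\sum_i n'_id_w(i)\ge\sum_i n_id_v(i)$. An $n$-dimensional representation $\phi$ of $\pi_1(\mathcal{S}_G)$ on $N$ yields an $n$-dimension vector $\alpha$ via $N{\downarrow}_{S_v}\cong\bigoplus_i (V_i^{(v)})^{\oplus\alpha_i^{(v)}}$ and a point $M_\phi\in rep_\alpha Q_0(\mathcal{S}_G)$ given by the matrices, in bases adapted to these decompositions, of the $S_e$-linear isomorphisms $N{\downarrow}_{S_v}\to N{\downarrow}_{S_w}$ for the edges $e:v\to w$ (the identity for $e\in T$, the action of $t_e^{-1}$ for $e\notin T$). The component of the representation scheme of $\pi_1(\mathcal{S}_G)$ consisting of the $\phi$ with associated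 dimension vector $\alpha$ is denoted $rep_\alpha\,\pi_1(\mathcal{S}_G)$, and its representations are regarded as points of $rep_\alpha Q_0(\mathcal{S}_G)$ via $\phi\mapsto M_\phi$. With $\chi_0$ the Euler form of $Q_0(\mathcal{S}_G)$ (matrix entries $\delta_{ij}-\#\{\text{arrows } i\to j\}$), the one-quiver $Q_1(\mathcal{S}_G)$ is defined as follows: let $\{\alpha_1,\dots,\alpha_k\}$ be the minimal set of generators of the semigroup of dimension vectors $\alpha$ of $Q_0(\mathcal{S}_G)$ that are $n$-dimension vectors for some $n\in\mathbb{N}$ and such that $rep_\alpha Q_0(\mathcal{S}_G)$ contains $\mathcal{S}_G$-semistable representations. Its vertices are $\nu_1,\dots,\nu_k$, with $\delta_{ij}-\chi_0(\alpha_i,\alpha_j)$ arrows from $\nu_i$ to $\nu_j$. Identification of the normal space: the normal space to $\mathcal{O}(M)$ at $M$ (a complement, stable under the stabilizer $GL(\gamma)=\prod_i GL(c_i)$ of $M$, to the tangent space of $\mathcal{O}(M)$ in $rep_\alpha Q_0(\mathcal{S}_G)$) is isomorphic to $\mathrm{Ext}^1_{\pi_1(\mathcal{S}_G)}(M,M)$, which is identified with $rep_\gamma Q_1(\mathcal{S}_G)$; $N_M$ is the translate of this complement through $M$. *)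

(* Defs.v *)
From HB Require Import structures.
From mathcomp Require Import all_boot all_order all_algebra all_field.
From mathcomp Require Import mpoly.

Set Implicit Arguments.
Unset Strict Implicit.
Unset Printing Implicit Defensive.

Import GRing.Theory.
Local Open Scope ring_scope.

Section Modules.
Variable F : fieldType.

(* A module of dimension n over A is an action rho : A -> 'M_n on column
   vectors. A decomposition is an isomorphism of rho with the direct sum of
   m i copies of sigma i, i in I, given by the inclusion and the projection of
   every copy; a copy is an element of {i : I & 'I_(m i)}. *)
Record decomposition (A : Type) (n : nat) (rho : A -> 'M[F]_n) (I : finType)
    (d : I -> nat) (sigma : forall i, A -> 'M[F]_(d i)) (m : I -> nat) :=
  Decomposition {
    inc : forall x : {i : I & 'I_(m i)}, 'M[F]_(n, d (tag x));
    prj : forall x : {i : I & 'I_(m i)}, 'M[F]_(d (tag x), n);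
    inc_hom : forall x s, rho s *m inc x = inc x *m sigma (tag x) s;
    prj_hom : forall x s, prj x *m rho s = sigma (tag x) s *m prj x;
    prj_inc : forall x, prj x *m inc x = 1%:M;
    prj_inc0 : forall x y, x != y -> prj x *m inc y = 0;
    sum_inc_prj : \sum_x inc x *m prj x = 1%:M
  }.

Definition simple_rep (A : Type) (n : nat) (rho : A -> 'M[F]_n) : Prop :=
  (0 < n)%N /\
  forall U : {vspace 'cV[F]_n},
    (forall s u, u \in U -> rho s *m u \in U) -> U = 0%VS \/ U = fullv.

Definition left_ideal (A : falgType F) (I : {vspace A}) : Prop :=
  forall a x : A, x \in I -> a * x \in I.

Definition semisimple (A : falgType F) : Prop :=
  forall I : {vspace A}, left_ideal I ->
  exists J : {vspace A},
    [/\ left_ideal J, (I + J)%VS = fullv & (I :&: J)%VS = 0%VS].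

(* sa_simple i is the action on the i-th simple module V_i; sa_wedderburn says
   that these actions together identify the algebra with the direct sum of the
   matrix algebras 'M_(sa_d i), a description which is available for every
   semisimple algebra over an algebraically closed field. *)
Record separable_algebra := SeparableAlgebra {
  sa_alg :> falgType F;
  sa_semisimple : semisimple sa_alg;
  sa_n : nat;
  sa_d : 'I_sa_n -> nat;
  sa_d_gt0 : forall i, (0 < sa_d i)%N;
  sa_simple : forall i, {lrmorphism sa_alg -> 'M[F]_(sa_d i)};
  sa_wedderburn : forall m : forall i, 'M[F]_(sa_d i),
    exists! s : sa_alg, forall i, sa_simple i s = m i
}.

(* [g_end e false] is the origin v and [g_end e true] the target w of the
   oriented edge e : v -> w; a loop has two (possibly different) embeddings.
   [g_mult e b k i] is the multiplicity of the k-th simple S_e-module in the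
   restriction of the i-th simple module at the end b of e, and [g_res e b i]
   a chosen decomposition which realizes these multiplicities. *)
Record separable_graph := SeparableGraph {
  g_V : finType;
  g_E : finType;
  g_end : g_E -> bool -> g_V;
  g_SV : g_V -> separable_algebra;
  g_SE : g_E -> separable_algebra;
  g_emb : forall e b, {lrmorphism g_SE e -> g_SV (g_end e b)};
  g_emb_inj : forall e b, injective (g_emb e b);
  g_mult : forall e b,
    'I_(sa_n (g_SE e)) -> 'I_(sa_n (g_SV (g_end e b))) -> nat;
  g_res : forall e b i,
    decomposition (fun s => @sa_simple (g_SV (g_end e b)) i (g_emb e b s))
      (fun k => @sa_simple (g_SE e) k) (fun k => g_mult k i)
}.

End Modules.

Section Graphs.
Variables (F : fieldType) (S : separable_graph F).

Definition adjacent (D : {set g_E S}) : rel (g_V S) :=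
  [rel v w | [exists e in D, exists b,
                (g_end e b == v) && (g_end e (~~ b) == w)]].

Definition connected_graph : Prop :=
  (0 < #|g_V S|)%N /\ forall v w, connect (adjacent setT) v w.

(* The second clause says that T contains no circuit (in particular no loop).
   The maximal subtrees of a connected graph are its spanning trees. *)
Definition maximal_subtree (T : {set g_E S}) : Prop :=
  (forall v w, connect (adjacent T) v w) /\
  forall e, e \in T ->
    ~~ connect (adjacent (T :\ e)) (g_end e false) (g_end e true).

End Graphs.

Section FundamentalAlgebra.
Variable F : fieldType.

(* P = A *_C B, the pushout of a : C -> A and b : C -> B. *)
Definition amalgamated_product (C : Type) (A B P : algType F)
    (a : C -> A) (b : C -> B)
    (f : {lrmorphism A -> P}) (g : {lrmorphism B -> P}) : Prop :=
  (forall s, f (a s) = g (b s)) /\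
  forall (Q : algType F) (f' : {lrmorphism A -> Q}) (g' : {lrmorphism B -> Q}),
    (forall s, f' (a s) = g' (b s)) ->
    exists2 h : {lrmorphism P -> Q},
      (forall x, h (f x) = f' x) /\ (forall y, h (g y) = g' y) &
      forall h' : {lrmorphism P -> Q},
        (forall x, h' (f x) = f' x) -> (forall y, h' (g y) = g' y) -> h' =1 h.

(* P = A * F[t, t^-1] / (b(s) - t^-1 a(s) t : s in C), where t' is t^-1. *)
Definition hnn_construction (C : Type) (A P : algType F) (a b : C -> A)
    (f : {lrmorphism A -> P}) (t t' : P) : Prop :=
  [/\ t * t' = 1, t' * t = 1 & forall s, f (b s) = t' * f (a s) * t] /\
  forall (Q : algType F) (f' : {lrmorphism A -> Q}) (u u' : Q),
    u * u' = 1 -> u' * u = 1 -> (forall s, f' (b s) = u' * f' (a s) * u) ->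
    exists2 h : {lrmorphism P -> Q},
      [/\ forall x, h (f x) = f' x, h t = u & h t' = u'] &
      forall h' : {lrmorphism P -> Q},
        (forall x, h' (f x) = f' x) -> h' t = u -> h' t' = u' -> h' =1 h.

Variables (S : separable_graph F) (T : {set g_E S}).

(* [tree_amalgam W j]: A is the iterated amalgamated product of the S_v, v in
   W, along the edges of T used so far, and j v : S_v -> A is the canonical map
   for v in W (j v is unspecified for the other v). *)
Inductive tree_amalgam :
    {set g_V S} -> forall A : algType F, (forall v, g_SV v -> A) -> Prop :=
| Tree_start (v : g_V S) (A : algType F) (j : forall v, g_SV v -> A)
    (f : {lrmorphism g_SV v -> A}) :
    bijective f -> j v =1 f -> tree_amalgam [set v] j
| Tree_step (W : {set g_V S}) (A : algType F) (j : forall v, g_SV v -> A)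
    (e : g_E S) (b : bool) (P : algType F)
    (f : {lrmorphism A -> P})
    (g : {lrmorphism g_SV (g_end e (~~ b)) -> P})
    (j' : forall v, g_SV v -> P) :
    tree_amalgam W j -> e \in T -> g_end e b \in W -> g_end e (~~ b) \notin W ->
    amalgamated_product (fun s => j _ (g_emb e b s)) (g_emb e (~~ b)) f g ->
    (forall v, v \in W -> forall s, j' v s = f (j v s)) ->
    (forall s, j' _ s = g s) ->
    tree_amalgam (g_end e (~~ b) |: W) j'.

(* [hnn_tower D j t t']: A is obtained from the amalgamated product over T of
   all the S_v by the HNN-constructions for the edges of D, with stable letters
   t e and their inverses t' e, e in D (unspecified for the other e). *)
Inductive hnn_tower :
    {set g_E S} -> forall A : algType F,
    (forall v, g_SV v -> A) -> (g_E S -> A) -> (g_E S -> A) -> Prop :=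
| Hnn_start (A : algType F) (j : forall v, g_SV v -> A) (t t' : g_E S -> A) :
    tree_amalgam setT j -> hnn_tower set0 j t t'
| Hnn_step (D : {set g_E S}) (A : algType F) (j : forall v, g_SV v -> A)
    (t t' : g_E S -> A) (e : g_E S) (P : algType F)
    (f : {lrmorphism A -> P}) (j' : forall v, g_SV v -> P)
    (u u' : g_E S -> P) :
    hnn_tower D j t t' -> e \notin T -> e \notin D ->
    hnn_construction (fun s => j _ (g_emb e false s))
                     (fun s => j _ (g_emb e true s)) f (u e) (u' e) ->
    (forall v s, j' v s = f (j v s)) ->
    (forall e', e' \in D -> u e' = f (t e') /\ u' e' = f (t' e')) ->
    hnn_tower (e |: D) j' u u'.

Record fundamental_algebra := FundamentalAlgebra {
  pi1 :> algType F;
  pi1_incl : forall v, {lrmorphism g_SV v -> pi1};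
  pi1_t : g_E S -> pi1;
  pi1_tinv : g_E S -> pi1;
  pi1_tower : hnn_tower (~: T) (fun v => pi1_incl v : g_SV v -> pi1)
                pi1_t pi1_tinv
}.

End FundamentalAlgebra.

Record quiver := Quiver {
  qv : finType;
  qa : finType;
  qs : qa -> qv;
  qt : qa -> qv
}.

Definition dimvec (Q : quiver) : Type := {ffun qv Q -> nat}.

Definition arrows (Q : quiver) (x y : qv Q) : {set qa Q} :=
  [set a | (qs a == x) && (qt a == y)].

Definition euler_form (Q : quiver) (alpha beta : dimvec Q) : int :=
  \sum_x \sum_y (alpha x)%:Z * ((x == y)%:Z - #|arrows x y|%:Z) * (beta y)%:Z.

Section QuiverRepresentations.
Variables (F : fieldType) (Q : quiver) (alpha : dimvec Q).

Definition qrep : Type :=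
  {dffun forall a : qa Q, 'M[F]_(alpha (qt a), alpha (qs a))}.

HB.instance Definition _ := Choice.on qrep.

Definition qrep_zero : qrep := [ffun a => 0].
Definition qrep_opp (X : qrep) : qrep := [ffun a => - X a].
Definition qrep_add (X Y : qrep) : qrep := [ffun a => X a + Y a].
Definition qrep_scale (c : F) (X : qrep) : qrep := [ffun a => c *: X a].

Fact qrep_addA : associative qrep_add.
Proof. by move=> X Y Z; apply/ffunP=> a; rewrite !ffunE addrA. Qed.
Fact qrep_addC : commutative qrep_add.
Proof. by move=> X Y; apply/ffunP=> a; rewrite !ffunE addrC. Qed.
Fact qrep_add0 : left_id qrep_zero qrep_add.
Proof. by move=> X; apply/ffunP=> a; rewrite !ffunE add0r. Qed.
Fact qrep_addN : left_inverse qrep_zero qrep_opp qrep_add.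
Proof. by move=> X; apply/ffunP=> a; rewrite !ffunE addNr. Qed.

HB.instance Definition _ :=
  GRing.isZmodule.Build qrep qrep_addA qrep_addC qrep_add0 qrep_addN.

Fact qrep_scaleA b c X : qrep_scale b (qrep_scale c X) = qrep_scale (b * c) X.
Proof. by apply/ffunP=> a; rewrite !ffunE scalerA. Qed.
Fact qrep_scale1 : left_id 1 qrep_scale.
Proof. by move=> X; apply/ffunP=> a; rewrite !ffunE scale1r. Qed.
Fact qrep_scaleDr : right_distributive qrep_scale +%R.
Proof. by move=> c X Y; apply/ffunP=> a; rewrite !ffunE scalerDr. Qed.
Fact qrep_scaleDl X : {morph qrep_scale^~ X : b c / b + c}.
Proof. by move=> b c; apply/ffunP=> a; rewrite !ffunE scalerDl. Qed.

HB.instance Definition _ :=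
  GRing.Zmodule_isLmodule.Build F qrep
    qrep_scaleA qrep_scale1 qrep_scaleDr qrep_scaleDl.

Definition base_change : Type := forall x : qv Q, 'M[F]_(alpha x).

Definition in_GL (g : base_change) : Prop := forall x, g x \in unitmx.

Definition qact (g : base_change) (X : qrep) : qrep :=
  [ffun a => g (qt a) *m X a *m invmx (g (qs a))].

Definition orbit_of (M X : qrep) : Prop :=
  exists2 g : base_change, in_GL g & X = qact g M.

Definition coord_index : finType :=
  {a : qa Q & ('I_(alpha (qt a)) * 'I_(alpha (qs a)))%type}.

Definition qcoord (X : qrep) (r : 'I_#|coord_index|) : F :=
  X (tag (enum_val r)) (tagged (enum_val r)).1 (tagged (enum_val r)).2.

Definition zariski_open (U : qrep -> Prop) : Prop :=
  exists P : {mpoly F[#|coord_index|]} -> Prop,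
    forall X, U X <-> exists2 p, P p & p.@[qcoord X] != 0.

(* The Zariski tangent space at M of a locally closed subset Z: the
   differentials at M of all polynomials that vanish on Z vanish on Y. *)
Definition zariski_tangent (Z : qrep -> Prop) (M Y : qrep) : Prop :=
  forall p : {mpoly F[#|coord_index|]},
    (forall X, Z X -> p.@[qcoord X] = 0) ->
    \sum_r (mderiv r p).@[qcoord M] * qcoord Y r = 0.

End QuiverRepresentations.

Section ZariskiQuiver.
Variables (F : fieldType) (S : separable_graph F).

Definition Q0_vertex : finType := {v : g_V S & 'I_(sa_n (g_SV v))}.

Definition mu (v : g_V S) (i : 'I_(sa_n (g_SV v))) : Q0_vertex :=
  Tagged (fun v => 'I_(sa_n (g_SV v))) i.

Arguments mu {v} i.

(* The arrows from mu_i to mu_j given by the edge e are the triples (k, p, q),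
   p (resp. q) being a copy of the k-th simple S_e-module in the restriction of
   V_i (resp. V_j); their number is the sum over k of a_ki * a_kj. *)
Definition edge_arrow (e : g_E S) : finType :=
  {ijk : 'I_(sa_n (g_SV (g_end e false))) * 'I_(sa_n (g_SV (g_end e true)))
         * 'I_(sa_n (g_SE e)) &
     ('I_(g_mult ijk.2 ijk.1.1) * 'I_(g_mult ijk.2 ijk.1.2))%type}.

Definition Q0_arrow : finType := {e : g_E S & edge_arrow e}.

Definition zariski_quiver : quiver :=
  @Quiver Q0_vertex Q0_arrow
    (fun a => mu (tag (tagged a)).1.1) (fun a => mu (tag (tagged a)).1.2).

Definition arrow (e : g_E S) (i : 'I_(sa_n (g_SV (g_end e false))))
    (j : 'I_(sa_n (g_SV (g_end e true)))) (k : 'I_(sa_n (g_SE e)))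
    (p : 'I_(g_mult k i)) (q : 'I_(g_mult k j)) : qa zariski_quiver :=
  Tagged edge_arrow
    (Tagged (fun ijk : 'I_(sa_n (g_SV (g_end e false)))
                       * 'I_(sa_n (g_SV (g_end e true))) * 'I_(sa_n (g_SE e)) =>
               ('I_(g_mult ijk.2 ijk.1.1) * 'I_(g_mult ijk.2 ijk.1.2))%type)
       ((p, q) : 'I_(g_mult (i, j, k).2 (i, j, k).1.1)
                 * 'I_(g_mult (i, j, k).2 (i, j, k).1.2))).

Definition n_dimension_vector (n : nat) (alpha : dimvec zariski_quiver) : Prop :=
  forall v : g_V S, (\sum_i sa_d i * alpha (@mu v i) = n)%N.

(* U and U' range over the components at the origin and at the target of e of
   the subrepresentations of M | Q_e; they are independent also when e is a
   loop. *)
Definition semistable (alpha : dimvec zariski_quiver) (M : qrep F alpha) : Prop :=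
  forall (e : g_E S)
    (U : forall i, {vspace 'cV[F]_(alpha (@mu (g_end e false) i))})
    (U' : forall j, {vspace 'cV[F]_(alpha (@mu (g_end e true) j))}),
    (forall i j k (p : 'I_(g_mult k i)) (q : 'I_(g_mult k j)) u,
       u \in U i -> M (@arrow e i j k p q) *m u \in U' j) ->
    (\sum_i \dim (U i) * sa_d i <= \sum_j \dim (U' j) * sa_d j)%N.

Definition semistable_dimvec (alpha : dimvec zariski_quiver) : Prop :=
  (exists n, n_dimension_vector n alpha) /\
  exists M : qrep F alpha, semistable M.

End ZariskiQuiver.

Arguments mu {F S v} i.

Section Generators.
Variable Q : quiver.

Definition generates (P : dimvec Q -> Prop) (k : nat) (a : 'I_k -> dimvec Q)
    (J : {set 'I_k}) : Prop :=
  (forall i, i \in J -> P (a i)) /\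
  forall beta, P beta ->
    exists c : 'I_k -> nat, beta = \sum_(i in J) a i *+ c i.

Definition minimal_generators (P : dimvec Q -> Prop) (k : nat)
    (a : 'I_k -> dimvec Q) : Prop :=
  generates P a setT /\ forall J : {set 'I_k}, J \proper setT -> ~ generates P a J.

End Generators.

(* The number delta_ij - chi(a i, a j) of arrows is the dimension of an Ext^1
   whenever simple representations of dimension a i and a j exist; a negative
   value counts as 0. *)
Definition one_quiver_arrows (Q : quiver) (k : nat) (a : 'I_k -> dimvec Q)
    (i j : 'I_k) : nat :=
  if ((i == j)%:Z - euler_form (a i) (a j))%R is Posz n then n else 0%N.

Definition one_quiver (Q : quiver) (k : nat) (a : 'I_k -> dimvec Q) : quiver :=
  @Quiver 'I_k {ij : 'I_k * 'I_k & 'I_(one_quiver_arrows a ij.1 ij.2)}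
    (fun x => (tag x).1) (fun x => (tag x).2).

Section Representations.
Variables (F : fieldType) (S : separable_graph F) (T : {set g_E S}).
Variable P : fundamental_algebra T.

(* A point of rep_alpha pi_1 together with bases of its underlying space N
   adapted to the isomorphisms of the restrictions of N with the sums of
   alpha_i copies of V_i, one for every vertex. *)
Record pi1_rep (alpha : dimvec (zariski_quiver S)) := Pi1Rep {
  pr_dim : nat;
  pr_act :> {lrmorphism P -> 'M[F]_pr_dim};
  pr_dec : forall v : g_V S,
    decomposition (fun s => pr_act (pi1_incl P v s)) (fun i => @sa_simple _ (g_SV v) i)
      (fun i => alpha (mu i))
}.

Definition edge_iso alpha (N : pi1_rep alpha) (e : g_E S) : 'M[F]_(pr_dim N) :=
  if e \in T then 1%:M else N (pi1_tinv P e).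

Definition vertex_copy (alpha : dimvec (zariski_quiver S)) (v : g_V S)
    (i : 'I_(sa_n (g_SV v))) (x : 'I_(alpha (mu i))) :
    {i : 'I_(sa_n (g_SV v)) & 'I_(alpha (mu i))} :=
  Tagged (fun i => 'I_(alpha (mu i))) x.

Definition edge_copy (e : g_E S) (b : bool)
    (i : 'I_(sa_n (g_SV (g_end e b)))) (k : 'I_(sa_n (g_SE e)))
    (p : 'I_(g_mult k i)) : {k : 'I_(sa_n (g_SE e)) & 'I_(g_mult k i)} :=
  Tagged (fun k => 'I_(g_mult k i)) p.

(* M = M_N in the bases chosen in N: between the copy p of the k-th simple
   S_e-module in the copy x of V_i and the copy q of it in the copy y of V_j,
   the edge isomorphism is the scalar M (arrow p q) y x. *)
Definition quiver_point alpha (N : pi1_rep alpha)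
    (M : qrep F (alpha : dimvec (zariski_quiver S))) : Prop :=
  forall (e : g_E S) i j k (p : 'I_(g_mult k i)) (q : 'I_(g_mult k j))
    (x : 'I_(alpha (mu i))) (y : 'I_(alpha (mu j))),
    prj (g_res j) (@edge_copy e true j k q)
      *m (prj (pr_dec N (g_end e true)) (vertex_copy y)
          *m edge_iso N e
          *m inc (pr_dec N (g_end e false)) (vertex_copy x))
      *m inc (g_res i) (@edge_copy e false i k p)
    = (M (arrow p q) y x)%:M.

Definition simple_locus alpha (X : qrep F (alpha : dimvec (zariski_quiver S))) :
    Prop :=
  exists2 N : pi1_rep alpha, simple_rep N & quiver_point N X.

Variables (k : nat) (a : 'I_k -> dimvec (zariski_quiver S)).
Variables (SS : forall i, pi1_rep (a i)).
Variables (gamma : dimvec (one_quiver a)) (alpha : dimvec (zariski_quiver S)).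
Variables (N : pi1_rep alpha)
  (D : decomposition N (fun i => SS i : P -> 'M[F]_(pr_dim (SS i))) gamma).

(* The automorphism of N = direct sum of the S_i^(c_i) given by g in
   GL(gamma), whose component from the copy q to the copy p of S_i is the scalar
   g i p q. *)
Definition GL_gamma_act (g : base_change F gamma) : 'M[F]_(pr_dim N) :=
  \sum_(i : 'I_k) \sum_(p < gamma i) \sum_(q < gamma i)
    g i p q *: (inc D (Tagged (fun i => 'I_(gamma i)) p)
                *m prj D (Tagged (fun i => 'I_(gamma i)) q)).

(* h is the element of GL(alpha) that g induces on the multiplicity spaces of
   the V_i in N. This is the identification of GL(gamma) with the stabilizer of
   M in GL(alpha). *)
Definition stabilizer_embedding (g : base_change F gamma)
    (h : base_change F alpha) : Prop :=
  forall (v : g_V S) i (x y : 'I_(alpha (mu i))),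
    prj (pr_dec N v) (vertex_copy y) *m GL_gamma_act g
      *m inc (pr_dec N v) (vertex_copy x) = (h (mu i) y x)%:M.

Record normal_identification (M : qrep F alpha)
    (iota : {linear qrep F gamma -> qrep F alpha}) : Prop := {
  ni_inj : injective iota;
  ni_stable : forall h : base_change F alpha,
    in_GL h -> qact h M = M ->
    forall V, exists V', qact h (iota V) = iota V';
  ni_tangent0 : forall V, zariski_tangent (orbit_of M) M (iota V) -> iota V = 0;
  ni_tangentD : forall Y, exists Z V,
    zariski_tangent (orbit_of M) M Z /\ Y = Z + iota V;
  ni_equivariant : forall g h, in_GL g -> stabilizer_embedding g h ->
    forall V, iota (qact g V) = qact h (iota V)
}.

Definition normal_slice (M : qrep F alpha)
    (iota : {linear qrep F gamma -> qrep F alpha}) (X : qrep F alpha) : Prop :=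
  exists V, X = M + iota V.

Definition GL_saturation (Z : qrep F alpha -> Prop) (X : qrep F alpha) : Prop :=
  exists g Y, [/\ in_GL g, Z Y & X = qact g Y].

End Representations.

(* Main.v *)
Require Import Defs.
From HB Require Import structures.
From mathcomp Require Import all_boot all_order all_algebra all_field.
From mathcomp Require Import mpoly boolp.

Set Implicit Arguments.
Unset Strict Implicit.
Unset Printing Implicit Defensive.

Import GRing.Theory.
Local Open Scope ring_scope.

(** Write C_X(h) for the representation a |-> h (target a) M_a - X_a h (source a),
    so that C_M is the differential at 1 of the orbit map of M.

    The slice N_M is transversal to the orbit of M, so that the map
    (g, V) |-> g.(M + V) is a submersion at (1, 0) and its image GL.N_M is dense;
    an image of a polynomial map that is dense contains a nonempty open set U,
    and U meets the simple locus because the latter is dense as well. Each step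
    has an elementary form.

    - Transversality is given for the Zariski tangent space of the orbit. This
      space is contained in the image of C_M: the rank of C_X is constant for X
      in the orbit, so the minors of C_X of size 1 + rank C_M vanish on the orbit,
      and the differential at M of a minor bordered by h = 1, which lies in the
      kernel of C_M, detects the directions outside the image of C_M
      [tangent_infinitesimal].

    - Every direction C_M(h) + V is then the direction at t = 0 of the curve
      (1 + t h).(M + t V) in GL.N_M. The lowest homogeneous part at M of a
      polynomial that vanishes on GL.N_M vanishes in all these directions, so the
      polynomial is zero [vanish_on_curves, saturated_slice_dense].

    - GL.N_M is definable by a first order formula. By quantifier elimination a
      definable set contains or misses a nonempty principal open set, and GL.N_M
      cannot miss one [definable_generic, saturated_slice_open].

    - Join the point X_0 of a simple representation to a point outside a given
      hypersurface by a line X_t. For almost all t the edge matrices of X_t are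
      invertible. Conjugating the action of S_v by matrices g_v(t) that are found
      by walking along the tree makes the edge matrices of T equal to 1 again, so
      that X_t is the point of a representation rho_t of the fundamental algebra,
      by the universal property of that algebra. The matrices rho_t(p) are
      regular functions of t near 0. By Burnside's theorem rho_0 is surjective, so
      n^2 elements p act by a basis of the matrices for t = 0, hence for almost
      all t, and then rho_t is simple [simple_locus_dense]. *)

(** * Regular functions of one parameter *)

Section Germs.
Variable F : closedFieldType.

(** Q holds for all but finitely many t; the exceptions are given as zeros of a
    polynomial, so that finitely many conditions are combined by a product. *)
Definition generic (Q : F -> Prop) : Prop :=
  exists2 r : {poly F}, r != 0 & forall t, r.[t] != 0 -> Q t.

Lemma generic_ex (Q : F -> Prop) : generic Q -> exists t, Q t.
Proof.
case=> r /closed_nonrootP[t rt] Qr.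
by exists t; apply: Qr.
Qed.

Lemma genericI (Q1 Q2 : F -> Prop) :
  generic Q1 -> generic Q2 -> generic (fun t => Q1 t /\ Q2 t).
Proof.
move=> [r1 r1n0 H1] [r2 r2n0 H2]; exists (r1 * r2); first by rewrite mulf_neq0.
by move=> t; rewrite hornerM mulf_eq0 negb_or => /andP[/H1 ? /H2].
Qed.

Lemma generic_sub (Q1 Q2 : F -> Prop) :
  (forall t, Q1 t -> Q2 t) -> generic Q1 -> generic Q2.
Proof. by move=> sub [r rn0 H]; exists r => // t /H/sub. Qed.

Lemma generic_all (I : finType) (Q : I -> F -> Prop) :
  (forall i, generic (Q i)) -> generic (fun t => forall i, Q i t).
Proof.
move=> H.
suff [r rn0 Hr] : exists2 r : {poly F}, r != 0 &
    forall t, r.[t] != 0 -> forall i, i \in enum I -> Q i t.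
  by exists r => // t /Hr Qt i; apply: Qt; rewrite mem_enum.
elim: (enum I) => [|i s [r rn0 Hr]]; first by exists 1; rewrite ?oner_neq0.
have [r' r'n0 Hr'] := H i; exists (r * r'); first by rewrite mulf_neq0.
move=> t; rewrite hornerM mulf_eq0 negb_or => /andP[/Hr Qr /Hr' Qi] j.
by rewrite inE => /orP[/eqP->|/Qr].
Qed.

Lemma generic_neq (a : F) : generic (fun t => t != a).
Proof.
exists ('X - a%:P); first by rewrite polyXsubC_eq0.
by move=> t; rewrite hornerXsubC subr_eq0.
Qed.

(** A rational function that is defined at 0, given by a total function whose
    values at the other zeros of the denominator are arbitrary. *)
Definition regular (f : F -> F) : Prop :=
  exists p q : {poly F}, q.[0] != 0 /\ forall t, q.[t] != 0 -> f t = p.[t] / q.[t].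

Lemma regular_poly (p : {poly F}) : regular (fun t => p.[t]).
Proof.
exists p, 1; split=> [|t _]; first by rewrite hornerC oner_neq0.
by rewrite hornerC divr1.
Qed.

Lemma regular_const (a : F) : regular (fun=> a).
Proof.
by have := regular_poly a%:P; congr regular; apply/funext=> t; rewrite hornerC.
Qed.

Lemma regular_id : regular id.
Proof.
by have := regular_poly 'X; congr regular; apply/funext=> t; rewrite hornerX.
Qed.

Lemma regularD (f g : F -> F) :
  regular f -> regular g -> regular (fun t => f t + g t).
Proof.
move=> [p1 [q1 [q10 H1]]] [p2 [q2 [q20 H2]]].
exists (p1 * q2 + p2 * q1), (q1 * q2); rewrite hornerM mulf_neq0 //; split=> // t.
rewrite !(hornerM, hornerD) mulf_eq0 negb_or => /andP[q1t q2t].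
by rewrite H1 // H2 // addf_div.
Qed.

Lemma regularM (f g : F -> F) :
  regular f -> regular g -> regular (fun t => f t * g t).
Proof.
move=> [p1 [q1 [q10 H1]]] [p2 [q2 [q20 H2]]].
exists (p1 * p2), (q1 * q2); rewrite hornerM mulf_neq0 //; split=> // t.
rewrite !hornerM mulf_eq0 negb_or => /andP[q1t q2t].
by rewrite H1 // H2 // mulf_div.
Qed.

Lemma regular_sum (I : Type) (r : seq I) (P : pred I) (f : I -> F -> F) :
  (forall i, P i -> regular (f i)) -> regular (fun t => \sum_(i <- r | P i) f i t).
Proof.
move=> Hf; elim: r => [|i r IH].
  by have := regular_const 0; congr regular; apply/funext=> t; rewrite big_nil.
case Pi: (P i); last first.
  by move: IH; congr regular; apply/funext=> t; rewrite big_cons Pi.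
have := regularD (Hf i Pi) IH; congr regular.
by apply/funext=> t; rewrite big_cons Pi.
Qed.

Lemma regular_prod (I : Type) (r : seq I) (P : pred I) (f : I -> F -> F) :
  (forall i, P i -> regular (f i)) -> regular (fun t => \prod_(i <- r | P i) f i t).
Proof.
move=> Hf; elim: r => [|i r IH].
  by have := regular_const 1; congr regular; apply/funext=> t; rewrite big_nil.
case Pi: (P i); last first.
  by move: IH; congr regular; apply/funext=> t; rewrite big_cons Pi.
have := regularM (Hf i Pi) IH; congr regular.
by apply/funext=> t; rewrite big_cons Pi.
Qed.

Lemma regularX (f : F -> F) n : regular f -> regular (fun t => f t ^+ n).
Proof.
move=> Hf; have := @regular_prod _ (iota 0 n) xpredT (fun=> f) (fun _ _ => Hf).
by congr regular; apply/funext=> t; rewrite big_const_seq count_predT size_iota iter_mulr_1.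
Qed.

Lemma regularV (f : F -> F) :
  f 0 != 0 -> regular f -> regular (fun t => (f t)^-1).
Proof.
move=> f0 [p [q [q0 H]]]; exists (q * q), (p * q).
have p0 : p.[0] != 0 by move: f0; rewrite H // mulf_eq0 negb_or => /andP[].
rewrite hornerM mulf_neq0 //; split=> // t.
rewrite !hornerM mulf_eq0 negb_or => /andP[pt qt].
by rewrite H // -[_ / (p.[t] * _)]mulf_div divff // mulr1 invf_div.
Qed.

Lemma regular_near (f : F -> F) : regular f -> f 0 != 0 ->
  exists2 r : {poly F}, r.[0] != 0 & forall t, r.[t] != 0 -> f t != 0.
Proof.
move=> [p [q [q0 H]]] f0.
have p0 : p.[0] != 0 by move: f0; rewrite H // mulf_eq0 negb_or => /andP[].
exists (p * q); first by rewrite hornerM mulf_neq0.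
move=> t; rewrite hornerM mulf_eq0 negb_or => /andP[pt qt].
by rewrite H // mulf_neq0 ?invr_neq0.
Qed.

Lemma regular_generic (f : F -> F) :
  regular f -> f 0 != 0 -> generic (fun t => f t != 0).
Proof.
move=> Hf /(regular_near Hf)[r r0 Hr]; exists r => //.
by apply: contraNneq r0 => ->; rewrite horner0.
Qed.

Lemma eq_near_regular (f g : F -> F) (r : {poly F}) : r.[0] != 0 ->
  (forall t, r.[t] != 0 -> f t = g t) -> regular f -> regular g.
Proof.
move=> r0 fg [p [q [q0 H]]]; exists (p * r), (q * r).
rewrite hornerM mulf_neq0 //; split=> // t.
rewrite !hornerM mulf_eq0 negb_or => /andP[qt rt].
by rewrite -mulf_div divff // mulr1 -fg // H.
Qed.

Lemma regular_eq0 (f : F -> F) :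
  regular f -> generic (fun t => f t = 0) -> f 0 = 0.
Proof.
move=> Hf f0; apply/eqP/contraT=> /(regular_generic Hf) Hn0.
by have [t [/eqP]] := generic_ex (genericI Hn0 f0).
Qed.

Definition mregular m n (B : F -> 'M[F]_(m, n)) : Prop :=
  forall i j, regular (fun t => B t i j).

Lemma mregular_const m n (A : 'M[F]_(m, n)) : mregular (fun=> A).
Proof. by move=> i j; apply: regular_const. Qed.

Lemma mregularD m n (A B : F -> 'M[F]_(m, n)) :
  mregular A -> mregular B -> mregular (fun t => A t + B t).
Proof.
move=> HA HB i j; have := regularD (HA i j) (HB i j).
by congr regular; apply/funext=> t; rewrite mxE.
Qed.

Lemma mregularZ m n (f : F -> F) (B : F -> 'M[F]_(m, n)) :
  regular f -> mregular B -> mregular (fun t => f t *: B t).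
Proof.
move=> HA HB i j; have := regularM HA (HB i j).
by congr regular; apply/funext=> t; rewrite mxE.
Qed.

Lemma mregularM m n p (A : F -> 'M[F]_(m, n)) (B : F -> 'M[F]_(n, p)) :
  mregular A -> mregular B -> mregular (fun t => A t *m B t).
Proof.
move=> HA HB i j.
have := @regular_sum _ (index_enum 'I_n) xpredT (fun k t => A t i k * B t k j)
  (fun k _ => regularM (HA i k) (HB k j)).
by congr regular; apply/funext=> t; rewrite mxE.
Qed.

Lemma mregular_sum m n (I : Type) (r : seq I) (P : pred I)
    (B : I -> F -> 'M[F]_(m, n)) :
  (forall i, P i -> mregular (B i)) -> mregular (fun t => \sum_(i <- r | P i) B i t).
Proof.
move=> H i j.
have := @regular_sum _ r P (fun k t => B k t i j) (fun k Pk => H k Pk i j).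
by congr regular; apply/funext=> t; rewrite summxE.
Qed.

Lemma regular_det n (B : F -> 'M[F]_n) :
  mregular B -> regular (fun t => \det (B t)).
Proof.
move=> HB; rewrite /determinant; apply: regular_sum => s _.
by apply: regularM; [apply: regular_const | apply: regular_prod => i _; apply: HB].
Qed.

Lemma mregular_adj n (B : F -> 'M[F]_n) :
  mregular B -> mregular (fun t => \adj (B t)).
Proof.
move=> HB i j; rewrite /adjugate /cofactor.
have : regular (fun t => (-1) ^+ (j + i) * \det (row' j (col' i (B t)))).
  apply: regularM; first exact: regular_const.
  apply: regular_det => a b; have := HB (lift j a) (lift i b).
  by congr regular; apply/funext=> t; rewrite !mxE.
by congr regular; apply/funext=> t; rewrite mxE.
Qed.

Lemma mregular_unit n (B : F -> 'M[F]_n) :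
  mregular B -> B 0 \in unitmx -> generic (fun t => B t \in unitmx).
Proof.
rewrite unitmxE unitfE => HB B0.
apply: generic_sub (regular_generic (regular_det HB) B0) => t.
by rewrite unitmxE unitfE.
Qed.

Lemma mregularV n (B : F -> 'M[F]_n) :
  mregular B -> B 0 \in unitmx -> mregular (fun t => invmx (B t)).
Proof.
rewrite unitmxE unitfE => HB B0 i j.
have detB := regular_det HB.
have [r r0 Hr] := regular_near detB B0.
apply: (eq_near_regular r0 _ (regularM (regularV B0 detB) (mregular_adj HB i j))) => t /Hr.
rewrite /= -unitfE -unitmxE /invmx => Bt.
by rewrite Bt [RHS]mxE.
Qed.

End Germs.

(** * Polynomials along curves *)

Section Polynomials.
Variable F : closedFieldType.

Lemma digits_inj (B n : nat) (a b : nat -> nat) :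
  (forall i, a i < B)%N -> (forall i, b i < B)%N ->
  (\sum_(i < n) a i * B ^ i = \sum_(i < n) b i * B ^ i)%N ->
  forall i, (i < n)%N -> a i = b i.
Proof.
elim: n a b => [|n IH] a b aB bB //.
have split_sum (c : nat -> nat) : (\sum_(i < n.+1) c i * B ^ i =
    (\sum_(i < n) c i.+1 * B ^ i) * B + c 0%N)%N.
  rewrite big_ord_recl expn0 muln1 addnC; congr addn.
  by rewrite big_distrl; apply: eq_bigr => i _; rewrite /= expnSr mulnA.
rewrite !split_sum => E.
have B0 : (0 < B)%N by apply: leq_ltn_trans (aB 0%N).
have [E0 Ed] : a 0%N = b 0%N /\
    (\sum_(i < n) a i.+1 * B ^ i = \sum_(i < n) b i.+1 * B ^ i)%N.
  split.
    by have := congr1 (modn^~ B) E; rewrite /= !modnMDl !modn_small.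
  by have := congr1 (divn^~ B) E; rewrite /= !divnMDl // !divn_small // !addn0.
case=> [|i] //; rewrite ltnS => /(IH (fun i => a i.+1) (fun i => b i.+1)) -> //.
Qed.

(** Kronecker's substitution: for large B, the monomials of p become distinct
    powers of t when the i-th variable is t ^ (B ^ i). *)
Lemma mpoly_nonzero_point n (p : {mpoly F[n]}) :
  p != 0 -> exists v, p.@[v] != 0.
Proof.
move=> p0; pose B := (msize p).+1.
pose k (m : 'X_{1..n}) := (\sum_(i < n) m i * B ^ i)%N.
have m_lt m i : m \in msupp p -> (m i < B)%N.
  move=> /msize_mdeg_lt mp; apply: leq_trans (leqnSn _).
  by apply: leq_ltn_trans mp; rewrite mdegE (bigD1 i) //= leq_addr.
have k_inj m m' : m \in msupp p -> m' \in msupp p -> k m = k m' -> m = m'.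
  move=> mp m'p E; apply/mnmP=> i.
  pose ext (m : 'X_{1..n}) j := if insub j is Some i then m i else 0%N.
  have extE m2 j : ext m2 (val (j : 'I_n)) = m2 j by rewrite /ext valK.
  have lt_ext m2 j : m2 \in msupp p -> (ext m2 j < B)%N.
    by rewrite /ext; case: insub => // j' /m_lt.
  rewrite -!extE; apply: (@digits_inj B n (ext m) (ext m') _ _ _ _ (ltn_ord i)) => [j|j|].
  - exact: lt_ext.
  - exact: lt_ext.
  - rewrite (eq_bigr (fun i => m i * B ^ i)%N) => [|j _]; last by rewrite extE.
    by rewrite [RHS](eq_bigr (fun i => m' i * B ^ i)%N) // => j _; rewrite extE.
pose P : {poly F} := \sum_(m <- msupp p) p@_m *: 'X^(k m).
have : P != 0.
  have /hasP[m0 m0p _] : has xpredT (msupp p).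
    by rewrite has_predT lt0n size_eq0 msupp_eq0.
  apply: contraTneq (m0p) => /(congr1 (fun q : {poly F} => q`_(k m0))).
  rewrite coef0 coef_sum (bigD1_seq m0) //= ?msupp_uniq //.
  rewrite coefZ coefXn eqxx mulr1 big1_seq ?addr0 => [/eqP|m].
    by rewrite mcoeff_eq0.
  case/andP=> m_m0 mp; rewrite coefZ coefXn; case: eqP => [E|_]; last by rewrite mulr0.
  by rewrite (k_inj _ _ m0p mp E) eqxx in m_m0.
move=> /closed_nonrootP[t]; rewrite rootE => Pt.
exists (fun i => t ^+ (B ^ i)); apply: contraNneq Pt => <-; apply/eqP.
rewrite mevalE /P horner_sum; apply: eq_bigr => m _.
rewrite hornerZ hornerXn -prodrXr; congr (_ * _).
by apply: eq_bigr => i _; rewrite exprAC -exprM mulnC.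
Qed.

(** The lowest homogeneous part of u |-> p (x0 + u) can be read off from the
    lowest power of t on a curve x0 + t w(t), and depends there only on the
    initial direction w(0). *)
Lemma vanish_on_curves n (p : {mpoly F[n]}) (x0 : 'I_n -> F) :
  (forall v : 'I_n -> F, exists w : 'I_n -> F -> F,
     [/\ forall i, regular (w i), forall i, w i 0 = v i &
         generic (fun t => p.@[fun i => x0 i + t * w i t] = 0)]) ->
  p = 0.
Proof.
move=> curves; apply: contraTeq isT => p0.
pose p1 := p \mPo [tuple 'X_i + (x0 i)%:MP | i < n].
have p1E u : p1.@[u] = p.@[fun i => x0 i + u i].
  rewrite comp_mpoly_meval; apply: meval_eq => i.
  by rewrite tnth_mktuple mevalD mevalXU mevalC addrC.
have p1n0 : p1 != 0.
  have [v pv] := mpoly_nonzero_point p0.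
  apply: contraNneq pv => p10; rewrite -(meval0 (fun i => v i - x0 i)) -p10 p1E.
  by apply/eqP/meval_eq=> i; rewrite addrC subrK.
have : exists d, has (fun m : 'X_{1..n} => mdeg m == d) (msupp p1).
  have /hasP[m mp _] : has xpredT (msupp p1) by rewrite has_predT lt0n size_eq0 msupp_eq0.
  by exists (mdeg m); apply/hasP; exists m.
case/ex_minnP=> d /hasP[m0 m0p /eqP m0d] dmin.
have {}dmin m : m \in msupp p1 -> (d <= mdeg m)%N.
  by move=> mp; apply: dmin; apply/hasP; exists m.
pose pd := \sum_(m <- msupp p1 | mdeg m == d) p1@_m *: 'X_[m].
have /mpoly_nonzero_point[v] : pd != 0.
  apply: contraTneq (m0p) => /(congr1 (mcoeff m0)).
  rewrite mcoeff0 raddf_sum /= big_mkcond (bigD1_seq m0) //= ?msupp_uniq //.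
  rewrite m0d eqxx mcoeffZ mcoeffX eqxx mulr1 big1 ?addr0 => [/eqP|m /negPf m_m0].
    by rewrite mcoeff_eq0.
  by case: ifP => // _; rewrite mcoeffZ mcoeffX m_m0 mulr0.
case/negP; have [w [w_reg w0 pw]] := curves v.
pose f t := \sum_(m <- msupp p1) p1@_m * t ^+ (mdeg m - d) * \prod_i w i t ^+ m i.
have f_reg : regular f.
  apply: regular_sum => m _; apply: regularM.
    by apply: regularM; [apply: regular_const | exact: (regularX _ (regular_id F))].
  by apply: regular_prod => i _; apply: regularX.
suff -> : pd.@[v] = f 0.
  apply/eqP/(regular_eq0 f_reg).
  apply: generic_sub (genericI pw (generic_neq 0)) => t [pt tn0].
  apply: (mulfI (expf_neq0 d tn0)); rewrite mulr0 -pt -(p1E (fun i => t * w i t)) mevalE.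
  rewrite /f mulr_sumr big_seq [RHS]big_seq; apply: eq_bigr => m mp.
  rewrite mulrA [_ * (_ * t ^+ _)]mulrCA -exprD subnKC ?dmin // -mulrA; congr (_ * _).
  by rewrite mdegE -prodrXr -big_split; apply: eq_bigr => i _; rewrite /= exprMn.
rewrite /f /pd raddf_sum /= big_mkcond big_seq [RHS]big_seq.
apply: eq_bigr => m mp; rewrite mevalZ mevalX.
case: eqP => [->|/eqP md].
  rewrite subnn expr0 mulr1; congr (_ * _).
  by apply: eq_bigr => i _; rewrite w0.
by rewrite expr0n subn_eq0 leqNgt ltn_neqAle eq_sym md dmin //= mulr0 mul0r.
Qed.

End Polynomials.

(** * Generic constancy of definable sets *)

Section Elimination.
Variable F : closedFieldType.

Definition point_env n (x : 'I_n -> F) : seq F := [seq x i | i <- enum 'I_n].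

Lemma point_env_nth n (x : 'I_n -> F) (i : 'I_n) : (point_env x)`_i = x i.
Proof.
by rewrite /point_env (nth_map i) ?nth_ord_enum // size_enum_ord.
Qed.

Lemma rterm_poly n (t : GRing.term F) : GRing.rterm t ->
  exists p : {mpoly F[n]}, forall x, GRing.eval (point_env x) t = p.@[x].
Proof.
elim: t => //=.
- move=> i _; case: (ltnP i n) => [i_n|n_i].
    exists 'X_(Ordinal i_n) => x; rewrite mevalXU.
    exact: (point_env_nth x (Ordinal i_n)).
  by exists 0 => x; rewrite meval0 nth_default // size_map size_enum_ord.
- by move=> c _; exists c%:MP => x; rewrite mevalC.
- by move=> k _; exists (k%:R)%:MP => x; rewrite mevalC.
- move=> t1 IH1 t2 IH2 /andP[/IH1[p1 H1] /IH2[p2 H2]].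
  by exists (p1 + p2) => x; rewrite mevalD H1 H2.
- by move=> t1 IH1 /IH1[p1 H1]; exists (- p1) => x; rewrite mevalN H1.
- by move=> t1 IH1 k /IH1[p1 H1]; exists (p1 *+ k) => x; rewrite mevalMn H1.
- move=> t1 IH1 t2 IH2 /andP[/IH1[p1 H1] /IH2[p2 H2]].
  by exists (p1 * p2) => x; rewrite mevalM H1 H2.
- by move=> t1 IH1 k /IH1[p1 H1]; exists (p1 ^+ k) => x; rewrite rmorphXn /= H1.
Qed.

Lemma qf_generic n (f : GRing.formula F) : GRing.qf_form f && GRing.rformula f ->
  exists2 q : {mpoly F[n]}, q != 0 &
    exists b, forall x, q.@[x] != 0 -> GRing.qf_eval (point_env x) f = b.
Proof.
have join f1 f2 (op : bool -> bool -> bool) :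
    (exists2 q : {mpoly F[n]}, q != 0 &
      exists b, forall x, q.@[x] != 0 -> GRing.qf_eval (point_env x) f1 = b) ->
    (exists2 q : {mpoly F[n]}, q != 0 &
      exists b, forall x, q.@[x] != 0 -> GRing.qf_eval (point_env x) f2 = b) ->
    exists2 q : {mpoly F[n]}, q != 0 & exists b, forall x, q.@[x] != 0 ->
      op (GRing.qf_eval (point_env x) f1) (GRing.qf_eval (point_env x) f2) = b.
  move=> [q1 q1n0 [b1 H1]] [q2 q2n0 [b2 H2]].
  exists (q1 * q2); first by rewrite mulf_neq0.
  exists (op b1 b2) => x; rewrite mevalM mulf_eq0 negb_or => /andP[x1 x2].
  by rewrite H1 // H2.
elim: f => //=.
- by move=> b _; exists 1; rewrite ?oner_neq0 //; exists b.
- move=> t1 t2 /andP[/(rterm_poly n)[p1 H1] /(rterm_poly n)[p2 H2]].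
  have [E|p12] := eqVneq p1 p2.
    by exists 1; rewrite ?oner_neq0 //; exists true => x _; rewrite H1 H2 E eqxx.
  exists (p1 - p2); first by rewrite subr_eq0.
  exists false => x; rewrite mevalB subr_eq0 H1 H2.
  by move/negPf.
- move=> f1 IH1 f2 IH2 /andP[/andP[a b] /andP[c d]].
  by apply: (join f1 f2 andb); [apply: IH1; rewrite a c| apply: IH2; rewrite b d].
- move=> f1 IH1 f2 IH2 /andP[/andP[a b] /andP[c d]].
  by apply: (join f1 f2 orb); [apply: IH1; rewrite a c| apply: IH2; rewrite b d].
- move=> f1 IH1 f2 IH2 /andP[/andP[a b] /andP[c d]].
  by apply: (join f1 f2 implb); [apply: IH1; rewrite a c| apply: IH2; rewrite b d].
- move=> f1 IH1 /IH1[q q0 [b H]]; exists q => //; exists (~~ b) => x /H.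
  by move=> ->.
Qed.

(** Quantifier elimination over an algebraically closed field makes every
    definable set constructible, and a constructible subset of affine space
    contains or misses a nonempty open set. *)
Lemma definable_generic n (f : GRing.formula F) :
  exists2 q : {mpoly F[n]}, q != 0 &
    forall x y, q.@[x] != 0 -> q.@[y] != 0 ->
      GRing.holds (point_env x) f -> GRing.holds (point_env y) f.
Proof.
have wf := @ClosedFieldQE.wf_ex_elim F.
have ok := ClosedFieldQE.holds_ex_elim (@solve_monicpoly F).
have rf := GRing.to_rform_rformula f.
have [q q0 [b Hq]] := qf_generic n (GRing.quantifier_elim_wf wf rf).
exists q => // x y /Hq qx /Hq qy /GRing.to_rformP fx.
apply/GRing.to_rformP/(GRing.quantifier_elim_rformP wf ok _ rf).
by rewrite qy -qx; apply/(GRing.quantifier_elim_rformP wf ok _ rf).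
Qed.

Definition definable (P : seq F -> Prop) : Prop :=
  exists f : GRing.formula F, forall e, GRing.holds e f <-> P e.

Definition definable_fun (h : seq F -> F) : Prop :=
  exists t : GRing.term F, forall e, GRing.eval e t = h e.

Lemma definable_eq (h1 h2 : seq F -> F) :
  definable_fun h1 -> definable_fun h2 -> definable (fun e => h1 e = h2 e).
Proof.
move=> [t1 H1] [t2 H2]; exists (t1 == t2)%T => e /=.
by rewrite H1 H2.
Qed.

Lemma definable_neq (h1 h2 : seq F -> F) :
  definable_fun h1 -> definable_fun h2 -> definable (fun e => h1 e <> h2 e).
Proof.
move=> [t1 H1] [t2 H2]; exists (~ (t1 == t2))%T => e /=.
by rewrite H1 H2.
Qed.

Lemma definableI (P1 P2 : seq F -> Prop) :
  definable P1 -> definable P2 -> definable (fun e => P1 e /\ P2 e).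
Proof.
move=> [f1 H1] [f2 H2]; exists (f1 /\ f2)%T => e /=.
by rewrite H1 H2.
Qed.

Lemma definable_all (I : finType) (P : I -> seq F -> Prop) :
  (forall i, definable (P i)) -> definable (fun e => forall i, P i e).
Proof.
move=> H; suff [f Hf] : definable (fun e => forall i, i \in enum I -> P i e).
  by exists f => e; rewrite Hf; split=> PI i *; apply: PI; rewrite ?mem_enum.
elim: (enum I) => [|i s [f Hf]]; first by exists (GRing.Bool true) => e; split.
have [g Hg] := H i; exists (g /\ f)%T => e /=; rewrite Hg Hf.
split=> [[Pi Ps] j|Ps]; first by rewrite inE => /orP[/eqP->|/Ps].
by split=> [|j js]; apply: Ps; rewrite inE ?eqxx ?js ?orbT.
Qed.

(** The variables in s are quantified existentially: e' is e except in those
    places. *)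
Lemma definable_ex (P : seq F -> Prop) (s : seq nat) : definable P ->
  definable (fun e => exists2 e', (forall i, i \notin s -> e'`_i = e`_i) & P e').
Proof.
move=> [f Hf]; exists (foldr GRing.Exists f s) => e.
rewrite -GRing.foldExistsP.
by split=> -[e' eqe /Hf Pe']; exists e' => // i /eqe.
Qed.

Lemma definable_var i : definable_fun (fun e => e`_i).
Proof. by exists ('X_i)%T. Qed.

Lemma definable_const c : definable_fun (fun=> c).
Proof. by exists (GRing.Const c). Qed.

Lemma definableD (h1 h2 : seq F -> F) :
  definable_fun h1 -> definable_fun h2 -> definable_fun (fun e => h1 e + h2 e).
Proof. by move=> [t1 H1] [t2 H2]; exists (t1 + t2)%T => e /=; rewrite H1 H2. Qed.

Lemma definableM (h1 h2 : seq F -> F) :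
  definable_fun h1 -> definable_fun h2 -> definable_fun (fun e => h1 e * h2 e).
Proof. by move=> [t1 H1] [t2 H2]; exists (t1 * t2)%T => e /=; rewrite H1 H2. Qed.

Lemma definable_sum (I : Type) (r : seq I) (P : pred I) (h : I -> seq F -> F) :
  (forall i, definable_fun (h i)) -> definable_fun (fun e => \sum_(i <- r | P i) h i e).
Proof.
move=> H; elim: r => [|i r [t Ht]].
  by exists (GRing.Const 0) => e; rewrite big_nil.
have [ti Hi] := H i; exists (if P i then ti + t else t)%T => e; rewrite big_cons.
by case: (P i); rewrite /= ?Hi Ht.
Qed.

Lemma definable_prod (I : Type) (r : seq I) (P : pred I) (h : I -> seq F -> F) :
  (forall i, definable_fun (h i)) -> definable_fun (fun e => \prod_(i <- r | P i) h i e).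
Proof.
move=> H; elim: r => [|i r [t Ht]].
  by exists (GRing.Const 1) => e; rewrite big_nil.
have [ti Hi] := H i; exists (if P i then ti * t else t)%T => e; rewrite big_cons.
by case: (P i); rewrite /= ?Hi Ht.
Qed.

End Elimination.

(** * First order variation of the rank of a matrix *)

Section LinearAlgebra.
Variable F : closedFieldType.

Lemma linear_mx m n (f : 'rV[F]_m -> 'rV[F]_n) (u : 'rV[F]_m) : linear f ->
  f u = u *m \matrix_(r, s) f (delta_mx 0 r) 0 s.
Proof.
move=> lin_f.
pose fL : {linear 'rV[F]_m -> 'rV[F]_n} := HB.pack f (GRing.isLinear.Build _ _ _ _ f lin_f).
rewrite {1}[u]row_sum_delta -[f _]/(fL _) linear_sum.
apply/rowP=> s; rewrite summxE !mxE; apply: eq_bigr => r _.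
by rewrite linearZ !mxE.
Qed.

Lemma poly_eq_fun (p q : {poly F}) : (forall t, p.[t] = q.[t]) -> p = q.
Proof.
move=> pq; apply/eqP; rewrite -subr_eq0; apply/contraT=> /closed_nonrootP[t].
by rewrite rootE hornerD hornerN pq subrr eqxx.
Qed.

(** The chain rule, along a line. *)
Lemma mpoly_directional n (p : {mpoly F[n]}) (x z : 'I_n -> F) (D : {poly F}) :
  (forall t, D.[t] = p.@[fun i => x i + t * z i]) ->
  D`_1 = \sum_i (mderiv i p).@[x] * z i.
Proof.
pose good p := exists2 D : {poly F}, forall t, D.[t] = p.@[fun i => x i + t * z i] &
  D`_1 = \sum_i (mderiv i p).@[x] * z i.
suff [D' D'E <-] : good p by move=> DE; rewrite (@poly_eq_fun D D') // => t; rewrite DE D'E.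
have D0 q D1 : (forall t, D1.[t] = q.@[fun i => x i + t * z i]) -> D1`_0 = q.@[x].
  by move=> DE; rewrite -horner_coef0 DE; apply: meval_eq => i; rewrite mul0r addr0.
have goodC c : good c%:MP.
  exists c%:P => [t|]; first by rewrite hornerC mevalC.
  by rewrite coefC big1 // => i _; rewrite mderivC meval0 mul0r.
have goodX i : good 'X_i.
  exists ((x i)%:P + z i *: 'X) => [t|].
    by rewrite mevalXU hornerD hornerC hornerZ hornerX mulrC.
  rewrite coefD coefC coefZ coefX mulr1 add0r (bigD1 i) //=.
  have U0 : (U_(i) - U_(i) = 0)%MM by apply/mnmP=> k; rewrite mnmBE mnm0E subnn.
  rewrite mderivX mnm1E eqxx U0 scale1r mpolyX0 meval1 mul1r big1 ?addr0 // => j ji.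
  by rewrite mderivX mnm1E eq_sym (negPf ji) scale0r meval0 mul0r.
have goodD p1 p2 : good p1 -> good p2 -> good (p1 + p2).
  move=> [D1 E1 H1] [D2 E2 H2]; exists (D1 + D2) => [t|]; first by rewrite hornerD mevalD E1 E2.
  rewrite coefD H1 H2 -big_split; apply: eq_bigr => i _ /=.
  by rewrite mderivD mevalD mulrDl.
have goodM p1 p2 : good p1 -> good p2 -> good (p1 * p2).
  move=> [D1 E1 H1] [D2 E2 H2]; exists (D1 * D2) => [t|]; first by rewrite hornerM mevalM E1 E2.
  rewrite coefM big_ord_recr big_ord1 /= subn0 H1 H2 (D0 _ _ E1) (D0 _ _ E2).
  rewrite mulr_sumr mulr_suml -big_split; apply: eq_bigr => i _ /=.
  by rewrite mderivM mevalD !mevalM mulrDl addrC mulrAC mulrA.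
have goodXn i k : good ('X_i ^+ k).
  by elim: k => [|k IHk]; rewrite ?expr0 ?exprS; [apply: (goodC 1) | apply: goodM].
elim/mpolyind: p => [|c m q _ _ IH]; first exact: goodC.
apply: goodD => //; rewrite -mul_mpolyC; apply: (goodM _ _ (goodC c)).
rewrite mpolyXE_id; elim: (index_enum _) => [|i s IHs].
  by rewrite big_nil; apply: (goodC 1).
by rewrite big_cons; apply: goodM.
Qed.

(** If z is not in the row space of A, then the rank of A increases to first
    order in any direction B that maps a vector e of the kernel of A to -z; the
    minor bordered by e and by a linear form that vanishes on the row space of A
    sees this. *)
Lemma bordered_minor m n (A : 'M[F]_(m, n)) (e : 'rV[F]_m) (z : 'rV[F]_n) :
  e *m A = 0 -> ~~ (z <= A)%MS ->
  exists (L : 'M[F]_(1 + \rank A, m)) (R : 'M[F]_(n, 1 + \rank A)),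
    forall B, e *m B = - z -> exists2 D : {poly F},
      forall t, D.[t] = \det (L *m (A + t *: B) *m R) & D`_1 != 0.
Proof.
move=> eA; rewrite submxE => /matrix0Pn[i0 [j zj]].
have {i0 zj} zj : (z *m cokermx A) 0 j != 0 by rewrite (ord1 i0) in zj.
(* The column l is a linear form that kills the rows of A and takes the value 1
   at z. *)
pose l := ((z *m cokermx A) 0 j)^-1 *: col j (cokermx A).
have Al : A *m l = 0.
  by rewrite /l -scalemxAr colE (mulmxA A) mulmx_coker mul0mx scaler0.
have zl : z *m l = 1%:M.
  have E : z *m col j (cokermx A) = col j (z *m cokermx A) by rewrite !colE (mulmxA z).
  rewrite /l -scalemxAr E [col j (z *m _)]mx11_scalar scale_scalar_mx.
  by rewrite [col j _ 0 0]mxE mulVf.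
pose L0 : 'M[F]_(\rank A, m) := pid_mx (\rank A) *m invmx (col_ebase A).
pose R0 : 'M[F]_(n, \rank A) := invmx (row_ebase A) *m pid_mx (\rank A).
have LAR : L0 *m A *m R0 = 1%:M.
  rewrite -[X in L0 *m X *m R0](mulmx_ebase A) /L0 /R0 !mulmxA mulmxKV ?col_ebase_unit //.
  rewrite mulmxK ?row_ebase_unit // !pid_mx_id ?rank_leq_row ?rank_leq_col //.
  by rewrite pid_mx_1.
move: l Al zl L0 R0 LAR => l Al zl L0 R0 LAR.
exists (col_mx e L0), (row_mx l R0) => B eB.
pose b := e *m B *m R0; pose c := L0 *m B *m l; pose d := L0 *m B *m R0.
have E t : col_mx e L0 *m (A + t *: B) *m row_mx l R0 =
    block_mx (t *: (- 1%:M)) (t *: b) (t *: c) (1%:M + t *: d).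
  rewrite mul_col_mx mul_col_row !(mulmxDr, mulmxDl) eA !mul0mx !add0r.
  rewrite -!scalemxAr -!scalemxAl eB !mulNmx zl LAR -mulmxA Al mulmx0 add0r.
  by rewrite /b /c /d eB mulNmx.
pose bP := map_mx polyC b; pose cP := map_mx polyC c; pose dP := map_mx polyC d.
pose K : 'M[{poly F}]_(1 + \rank A) := block_mx (- 1%:M) bP ('X *: cP) (1%:M + 'X *: dP).
have KE t : map_mx (fun p : {poly F} => p.[t]) K =
    block_mx (- 1%:M) b (t *: c) (1%:M + t *: d).
  rewrite map_block_mx; congr block_mx; apply/matrixP=> i k;
    rewrite ?(mxE, hornerE, hornerMn) //.
have detK t : (\det K).[t] = \det (block_mx (- 1%:M) b (t *: c) (1%:M + t *: d)).
  by rewrite -KE -[_.[t]]/(horner_eval t _) -det_map_mx.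
(* The first row of the bordered matrix is divisible by t, and K is what remains
   after the division; K becomes block triangular for t = 0. *)
exists ('X * \det K) => [t|].
  rewrite hornerM hornerX detK E.
  have -> : block_mx (t *: - 1%:M) (t *: b) (t *: c) (1%:M + t *: d) =
      block_mx (t%:M) 0 0 1%:M *m block_mx (- 1%:M) b (t *: c) (1%:M + t *: d).
    by rewrite mulmx_block !mul0mx !mul1mx !addr0 !add0r !mul_scalar_mx.
  by rewrite det_mulmx det_ublock det1 mulr1 det_scalar1.
rewrite coefXM /= -horner_coef0 detK !scale0r addr0 det_ublock det1 mulr1.
by rewrite -scaleN1r scalemx1 det_scalar1 oppr_eq0 oner_neq0.
Qed.

End LinearAlgebra.

(** * Tangent spaces of orbits *)

Section QuiverOrbits.
Variables (F : closedFieldType) (Q : quiver) (alpha : dimvec Q).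
Implicit Types (X Y Z M : qrep F alpha) (g h : base_change F alpha).

Lemma qrepDE X Y a : (X + Y) a = X a + Y a.
Proof. by rewrite /GRing.add /= ffunE. Qed.

Lemma qrepZE c X a : (c *: X) a = c *: X a.
Proof. by rewrite /GRing.scale /= ffunE. Qed.

Lemma qactE g X a : qact g X a = g (qt a) *m X a *m invmx (g (qs a)).
Proof. by rewrite ffunE. Qed.

Definition arrow_entry (a : qa Q) (i : 'I_(alpha (qt a))) (j : 'I_(alpha (qs a))) :
    'I_#|coord_index alpha| :=
  enum_rank (Tagged (fun a : qa Q => ('I_(alpha (qt a)) * 'I_(alpha (qs a)))%type) (i, j)).

Lemma qcoord_entry X a i j : qcoord X (@arrow_entry a i j) = X a i j.
Proof. by rewrite /qcoord /arrow_entry enum_rankK. Qed.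

Lemma arrow_entryP (r : 'I_#|coord_index alpha|) :
  exists a i j, r = @arrow_entry a i j.
Proof.
case E: (enum_val r) => [a [i j]]; exists a, i, j.
by rewrite -[r]enum_valK E.
Qed.

Lemma qcoord_inj X Y : qcoord X =1 qcoord Y -> X = Y.
Proof.
move=> E; apply/ffunP=> a; apply/matrixP=> i j.
by rewrite -!qcoord_entry E.
Qed.

Lemma qcoordD X Y r : qcoord (X + Y) r = qcoord X r + qcoord Y r.
Proof. by rewrite /qcoord qrepDE mxE. Qed.

Lemma qcoordZ c X r : qcoord (c *: X) r = c * qcoord X r.
Proof. by rewrite /qcoord qrepZE mxE. Qed.

Definition qrep_of (z : 'I_#|coord_index alpha| -> F) : qrep F alpha :=
  [ffun a => \matrix_(i, j) z (@arrow_entry a i j)].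

Lemma qrep_ofE z : qcoord (qrep_of z) =1 z.
Proof.
move=> r; have [a [i [j ->]]] := arrow_entryP r.
by rewrite qcoord_entry ffunE mxE.
Qed.

(** Base changes are put into coordinates in order to speak of the rank of a
    linear map on them. *)
Definition base_index : finType := {x : qv Q & ('I_(alpha x) * 'I_(alpha x))%type}.

Definition vertex_entry (x : qv Q) (i j : 'I_(alpha x)) : 'I_#|base_index| :=
  enum_rank (Tagged (fun x => ('I_(alpha x) * 'I_(alpha x))%type) (i, j)).

Definition base_of (u : 'I_#|base_index| -> F) : base_change F alpha :=
  fun x => \matrix_(i, j) u (@vertex_entry x i j).

Definition base_coord (h : base_change F alpha) (r : 'I_#|base_index|) : F :=
  h (tag (enum_val r)) (tagged (enum_val r)).1 (tagged (enum_val r)).2.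

Lemma base_coordK h x : base_of (base_coord h) x = h x.
Proof. by apply/matrixP=> i j; rewrite mxE /base_coord enum_rankK. Qed.

(** The map C_X of the introduction. For X = M its image is the tangent space of
    the orbit, and h lies in the kernel of C_X iff h : M -> X is a morphism. *)
Definition defect M X h : qrep F alpha :=
  [ffun a => h (qt a) *m M a - X a *m h (qs a)].

Lemma defectE M X h a :
  defect M X h a = h (qt a) *m M a - X a *m h (qs a).
Proof. by rewrite ffunE. Qed.

Lemma defect_act M g h : in_GL g ->
  defect M (qact g M) h =
  [ffun a => g (qt a) *m defect M M (fun x => invmx (g x) *m h x) a].
Proof.
move=> gU; apply/ffunP=> a; rewrite !ffunE mulmxBr !mulmxA.
by rewrite mulmxV ?gU // mul1mx.
Qed.

Definition defect_mx M X : 'M[F]_(#|base_index|, #|coord_index alpha|) :=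
  \matrix_(r, s) qcoord (defect M X (base_of (delta_mx (0 : 'I_1) r 0))) s.

Definition coord_row X : 'rV[F]_#|coord_index alpha| := \row_s qcoord X s.

Lemma coord_rowE X i r : coord_row X i r = qcoord X r.
Proof. by rewrite mxE. Qed.

Lemma base_ofD (u v : 'rV[F]_#|base_index|) c x :
  base_of ((c *: u + v) 0) x = c *: base_of (u 0) x + base_of (v 0) x.
Proof. by apply/matrixP=> i j; rewrite !mxE. Qed.

Lemma defect_mxE M X (u : 'rV[F]_#|base_index|) :
  u *m defect_mx M X = coord_row (defect M X (base_of (u 0))).
Proof.
pose f (u : 'rV[F]_#|base_index|) := coord_row (defect M X (base_of (u 0))).
suff lin_f : linear f.
  rewrite -[RHS]/(f u) (linear_mx u lin_f); congr (_ *m _).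
  by apply/matrixP=> r s; rewrite !mxE.
move=> c v w; apply/rowP=> s; rewrite !mxE -qcoordZ -qcoordD; congr qcoord.
apply/ffunP=> a; rewrite qrepDE qrepZE !ffunE !base_ofD.
rewrite !mulmxDl !mulmxDr -!scalemxAl -!scalemxAr scalerBr.
by rewrite !opprD !addrA; congr (_ + _); rewrite addrAC.
Qed.

(** For X = g.M, the map C_X is C_M up to base changes at its source and its
    target. *)
Lemma defect_rank M X : orbit_of M X -> (\rank (defect_mx M X) <= \rank (defect_mx M M))%N.
Proof.
case=> g gU ->.
have [L HL] : exists L, forall u : 'rV_#|base_index|,
    \row_r base_coord (fun x => invmx (g x) *m base_of (u 0) x) r = u *m L.
  eexists=> u; apply: linear_mx (fun u : 'rV_#|base_index| =>
    \row_r base_coord (fun x => invmx (g x) *m base_of (u 0) x) r) u _.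
  move=> c v w; apply/rowP=> r; rewrite !mxE /base_coord.
  by rewrite base_ofD mulmxDr -scalemxAr !mxE.
have [R HR] : exists R, forall z : 'rV_#|coord_index alpha|,
    coord_row [ffun a => g (qt a) *m qrep_of (z 0) a] = z *m R.
  eexists=> z; apply: linear_mx (fun z : 'rV_#|coord_index alpha| =>
    coord_row [ffun a => g (qt a) *m qrep_of (z 0) a]) z _.
  move=> c v w; apply/rowP=> r; rewrite !mxE -qcoordZ -qcoordD; congr qcoord.
  apply/ffunP=> a; rewrite qrepDE qrepZE !ffunE scalemxAr -mulmxDr; congr (_ *m _).
  by apply/matrixP=> i j; rewrite !mxE.
have -> : defect_mx M (qact g M) = L *m defect_mx M M *m R.
  apply/row_matrixP=> r; rewrite !rowE defect_mxE defect_act // !mulmxA -HL.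
  rewrite defect_mxE -HR; congr coord_row; apply/ffunP=> a; rewrite !ffunE.
  congr (_ *m _); apply/matrixP=> i j; rewrite [RHS]mxE coord_rowE qcoord_entry.
  pose h x := invmx (g x) *m base_of (delta_mx (0 : 'I_1) r 0) x.
  have hE x : h x = base_of ((\row_r0 base_coord h r0) 0) x.
    by rewrite -[LHS](base_coordK h); apply/matrixP=> i' j'; rewrite !mxE.
  by rewrite ffunE -!hE.
by apply: leq_trans (mxrankM_maxl _ _) (mxrankM_maxr _ _).
Qed.

Definition polynomial_fun (f : qrep F alpha -> F) : Prop :=
  exists p : {mpoly F[#|coord_index alpha|]}, forall X, f X = p.@[qcoord X].

Lemma polynomial_const c : polynomial_fun (fun=> c).
Proof. by exists c%:MP => X; rewrite mevalC. Qed.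

Lemma polynomial_coord r : polynomial_fun (fun X => qcoord X r).
Proof. by exists 'X_r => X; rewrite mevalXU. Qed.

Lemma polynomialD f1 f2 :
  polynomial_fun f1 -> polynomial_fun f2 -> polynomial_fun (fun X => f1 X + f2 X).
Proof. by move=> [p1 H1] [p2 H2]; exists (p1 + p2) => X; rewrite mevalD H1 H2. Qed.

Lemma polynomialM f1 f2 :
  polynomial_fun f1 -> polynomial_fun f2 -> polynomial_fun (fun X => f1 X * f2 X).
Proof. by move=> [p1 H1] [p2 H2]; exists (p1 * p2) => X; rewrite mevalM H1 H2. Qed.

Lemma polynomial_sum (I : Type) (r : seq I) (P : pred I) (f : I -> qrep F alpha -> F) :
  (forall i, polynomial_fun (f i)) -> polynomial_fun (fun X => \sum_(i <- r | P i) f i X).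
Proof.
move=> H; elim: r => [|i r [p Hp]]; first by exists 0 => X; rewrite big_nil meval0.
have [q Hq] := H i; exists (if P i then q + p else p) => X; rewrite big_cons Hp.
by case: (P i); rewrite ?mevalD ?Hq.
Qed.

Lemma polynomial_prod (I : Type) (r : seq I) (P : pred I) (f : I -> qrep F alpha -> F) :
  (forall i, polynomial_fun (f i)) -> polynomial_fun (fun X => \prod_(i <- r | P i) f i X).
Proof.
move=> H; elim: r => [|i r [p Hp]]; first by exists 1 => X; rewrite big_nil meval1.
have [q Hq] := H i; exists (if P i then q * p else p) => X; rewrite big_cons Hp.
by case: (P i); rewrite ?mevalM ?Hq.
Qed.

Lemma polynomial_mulmx m n p (A : qrep F alpha -> 'M[F]_(m, n))
    (B : qrep F alpha -> 'M[F]_(n, p)) :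
  (forall i j, polynomial_fun (fun X => A X i j)) ->
  (forall i j, polynomial_fun (fun X => B X i j)) ->
  forall i j, polynomial_fun (fun X => (A X *m B X) i j).
Proof.
move=> HA HB i j.
have [q Hq] := polynomial_sum (index_enum _) xpredT
  (fun k => polynomialM (HA i k) (HB k j)).
by exists q => X; rewrite mxE Hq.
Qed.

Lemma polynomial_defect M r s : polynomial_fun (fun X => defect_mx M X r s).
Proof.
have [a [i [j ->]]] := arrow_entryP s.
set h := base_of (delta_mx (0 : 'I_1) r 0).
have H : polynomial_fun (fun X => (h (qt a) *m M a) i j +
    \sum_k (-1 * (qcoord X (arrow_entry i k) * h (qs a) k j))).
  apply: polynomialD; first exact: polynomial_const.
  apply: polynomial_sum => k; apply: polynomialM; first exact: polynomial_const.
  by apply: polynomialM; [apply: polynomial_coord | apply: polynomial_const].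
move: H; congr polynomial_fun; apply/funext=> X.
rewrite [RHS]mxE qcoord_entry ffunE [RHS]mxE [X in _ = _ + X]mxE [(X a *m _) i j]mxE -sumrN; congr (_ + _).
by apply: eq_bigr => k _; rewrite mulN1r qcoord_entry.
Qed.

(** The minors of C_X of size 1 + rank C_M vanish on the orbit. If Z were not in
    the image of C_M, then the differential at M of the minor bordered by the
    identity, which C_M kills and which C_(M + t Z) maps to - t Z, would not vanish
    at Z. *)
Lemma tangent_infinitesimal M Z : zariski_tangent (orbit_of M) M Z ->
  exists h, Z = defect M M h.
Proof.
move=> tanZ.
pose e : 'rV[F]_#|base_index| := \row_r base_coord (fun x => 1%:M) r.
have eE X : defect M X (base_of (e 0)) = [ffun a => M a - X a].
  have e1 x : base_of (e 0) x = 1%:M.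
    by rewrite -[RHS](base_coordK (fun x => 1%:M)); apply/matrixP=> i j; rewrite !mxE.
  by apply/ffunP=> a; rewrite !ffunE !e1 mul1mx mulmx1.
have eM : e *m defect_mx M M = 0.
  rewrite defect_mxE eE; apply/rowP=> r; rewrite !mxE.
  by have [a [i [j ->]]] := arrow_entryP r; rewrite qcoord_entry ffunE mxE mxE subrr.
have [/submxP[u zu]|zA] := boolP (coord_row Z <= defect_mx M M)%MS.
  exists (base_of (u 0)); apply: qcoord_inj => r.
  by have /rowP/(_ r) := zu; rewrite defect_mxE !mxE.
have [L [R LR]] := bordered_minor eM zA.
have [q Hq] : polynomial_fun (fun X => \det (L *m defect_mx M X *m R)).
  have H i j : polynomial_fun (fun X => (L *m defect_mx M X *m R) i j).
    apply: polynomial_mulmx => [i' j'|i' j']; last exact: polynomial_const.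
    apply: polynomial_mulmx => [i2 j2|i2 j2]; first exact: polynomial_const.
    exact: polynomial_defect.
  rewrite /determinant; apply: polynomial_sum => s; apply: polynomialM; first exact: polynomial_const.
  by apply: polynomial_prod => i.
pose B := defect_mx M (M + Z) - defect_mx M M.
have BE t : defect_mx M (M + t *: Z) = defect_mx M M + t *: B.
  apply/matrixP=> r s; rewrite !mxE.
  have [a [i [j ->]]] := arrow_entryP s; rewrite !qcoord_entry !defectE.
  rewrite !qrepDE qrepZE !mulmxDl !opprD -scalemxAl !mxE.
  set c1 := \sum_ _ _; set c2 := \sum_ _ _; set c3 := \sum_ _ _.
  by rewrite ![c1 + (_ - _)]addrA [X in t * X]addrAC subrr add0r mulrN.
have eB : e *m B = - coord_row Z.
  rewrite mulmxBr eM subr0 defect_mxE eE; apply/rowP=> r; rewrite !mxE.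
  have [a [i [j ->]]] := arrow_entryP r; rewrite !qcoord_entry ffunE qrepDE.
  by rewrite opprD addrA subrr add0r !mxE.
have [D DE /negP[]] := LR B eB; apply/eqP.
rewrite (@mpoly_directional _ _ q (qcoord M) (qcoord Z)) ?tanZ // => [X OX|t].
  rewrite -Hq; apply/eqP/contraT; rewrite -unitfE -unitmxE -row_free_unit => /eqP fullrk.
  have := defect_rank OX; rewrite leqNgt => /negP[].
  apply: leq_trans (mxrankM_maxr L _).
  by apply: leq_trans (mxrankM_maxl _ R); rewrite fullrk.
rewrite DE -BE Hq; apply: meval_eq => r.
by rewrite qcoordD qcoordZ.
Qed.

End QuiverOrbits.

(** * The saturation of a transversal slice *)

Section OpenImage.
Variables (F : closedFieldType) (Q Q1 : quiver).
Variables (alpha : dimvec Q) (gamma : dimvec Q1).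
Variables (M : qrep F alpha) (iota : {linear qrep F gamma -> qrep F alpha}).

Hypothesis transversal : forall Y : qrep F alpha,
  exists h V, Y = defect M M h + iota V.

Definition saturated_slice (X : qrep F alpha) : Prop :=
  exists g V, in_GL g /\ X = qact g (M + iota V).

(** The curve qact (1 + t h) (M + t V) in the saturated slice leaves M in the
    direction defect M M h + V, an arbitrary one by transversality. *)
Lemma saturated_slice_dense (p : {mpoly F[#|coord_index alpha|]}) :
  (forall X, saturated_slice X -> p.@[qcoord X] = 0) -> p = 0.
Proof.
move=> p0; apply: (@vanish_on_curves _ _ p (qcoord M)) => v.
have [h [V Y_hV]] := transversal (qrep_of v).
pose H x (t : F) : 'M[F]_(alpha x) := 1%:M + t *: h x.
have H_reg x : mregular (H x).
  apply: mregularD; first exact: mregular_const.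
  by apply: mregularZ; [apply: regular_id | apply: mregular_const].
have H0 x : H x 0 = 1%:M by rewrite /H scale0r addr0.
pose w t : qrep F alpha := [ffun a =>
  (defect M M h a + H (qt a) t *m iota V a) *m invmx (H (qs a) t)].
exists (fun r t => qcoord (w t) r); split=> [r|r|].
- have [a [i [j ->]]] := arrow_entryP r.
  have : mregular (fun t =>
      (defect M M h a + H (qt a) t *m iota V a) *m invmx (H (qs a) t)).
    apply: mregularM; last by apply: mregularV; rewrite ?H0 ?unitmx1.
    apply: mregularD; first exact: mregular_const.
    by apply: mregularM => //; apply: mregular_const.
  move=> /(_ i j) wij.
  apply: (eq_near_regular (r := 1)) wij => [|t _]; first by rewrite hornerC oner_neq0.
  by rewrite qcoord_entry [w t a]ffunE.
- rewrite -(qrep_ofE v r) Y_hV; congr qcoord; apply/ffunP=> a.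
  by rewrite qrepDE ffunE !H0 invmx1 mul1mx mulmx1.
have : generic (fun t => forall x, H x t \in unitmx).
  by apply: generic_all => x; apply: mregular_unit; rewrite ?H0 ?unitmx1.
apply: generic_sub => t Hu.
rewrite -(p0 (qact (fun x => H x t) (M + iota (t *: V)))); last first.
  by exists (fun x => H x t), (t *: V).
apply: meval_eq => r; rewrite -qcoordZ -qcoordD; congr qcoord; apply/ffunP=> a.
rewrite linearZ qactE !qrepDE !qrepZE [w t a]ffunE defectE.
apply: (canRL (mulmxK (Hu _))); rewrite mulmxDl -scalemxAl mulmxKV ?Hu //.
rewrite /H mulmxDr mulmxDl !mulmxDr !mulmxDl !mulmx1 !mul1mx -!scalemxAr -!scalemxAl.
rewrite !scalerDr scalerN !scalerA -!addrA; congr (_ + _).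
set x := t *: (M a *m _); set y := t *: (_ *m M a).
by rewrite addrCA (addrA x) subrr add0r.
Qed.

Definition mdefinable m n (A : seq F -> 'M[F]_(m, n)) : Prop :=
  forall i j, definable_fun (fun e => A e i j).

Lemma mdefinableM m n p (A : seq F -> 'M[F]_(m, n)) (B : seq F -> 'M[F]_(n, p)) :
  mdefinable A -> mdefinable B -> mdefinable (fun e => A e *m B e).
Proof.
move=> HA HB i j.
have [t Ht] := definable_sum (index_enum _) xpredT
  (fun k => definableM (HA i k) (HB k j)).
by exists t => e; rewrite Ht mxE.
Qed.

Lemma definable_det n (A : seq F -> 'M[F]_n) :
  mdefinable A -> definable_fun (fun e => \det (A e)).
Proof.
move=> HA; rewrite /determinant; apply: definable_sum => s; apply: definableM.
  exact: definable_const.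
by apply: definable_prod => i; apply: HA.
Qed.

(* In the formula that defines the saturated slice, the first n variables are the
   coordinates of X; the following ones are those of g and of V and are
   quantified. *)
Let n := #|coord_index alpha|.
Let n_g := #|base_index alpha|.
Let n_V := #|coord_index gamma|.

Let X_of (e : seq F) : qrep F alpha := qrep_of (fun r => e`_r).
Let g_of (e : seq F) : base_change F alpha := base_of (fun r => e`_(n + r)).
Let V_of (e : seq F) : qrep F gamma := qrep_of (fun r => e`_(n + n_g + r)).

Let E_ (r : 'I_n_V) : qrep F gamma := qrep_of (fun r' => (r' == r)%:R).

Let iota_coord V : iota V = \sum_r qcoord V r *: iota (E_ r).
Proof.
have {1}-> : V = \sum_r qcoord V r *: E_ r.
  apply: qcoord_inj => s.
  have H (I : seq 'I_n_V) (c : 'I_n_V -> F) (Y : 'I_n_V -> qrep F gamma) :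
      qcoord (\sum_(r <- I) c r *: Y r) s = \sum_(r <- I) c r * qcoord (Y r) s.
    elim: I => [|r I IH]; last by rewrite !big_cons qcoordD qcoordZ IH.
    by rewrite !big_nil -(scale0r (0 : qrep F gamma)) qcoordZ mul0r.
  rewrite H (bigD1 s) //= qrep_ofE eqxx mulr1 big1 ?addr0 // => r /negPf rs.
  by rewrite qrep_ofE eq_sym rs mulr0.
by rewrite linear_sum; apply: eq_bigr => r _; rewrite linearZ.
Qed.

Let mdefinable_slice a : mdefinable (fun e => (M + iota (V_of e)) a).
Proof.
move=> i j.
have [t Ht] : definable_fun (fun e : seq F =>
    M a i j + \sum_(r < n_V) e`_(n + n_g + r) * iota (E_ r) a i j).
  apply: definableD; first exact: definable_const.
  apply: definable_sum => r; apply: definableM; first exact: definable_var.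
  exact: definable_const.
exists t => e; rewrite Ht iota_coord qrepDE [RHS]mxE; congr (_ + _).
have H (I : seq 'I_n_V) (c : 'I_n_V -> F) (Y : 'I_n_V -> qrep F alpha) :
    (\sum_(r <- I) c r *: Y r) a i j = \sum_(r <- I) c r * Y r a i j.
  elim: I => [|r I IH]; first by rewrite !big_nil -(scale0r (0 : qrep F alpha)) qrepZE mxE mul0r.
  by rewrite !big_cons qrepDE qrepZE [LHS]mxE IH [X in X + _ = _]mxE.
by rewrite H; apply: eq_bigr => r _; rewrite qrep_ofE.
Qed.

Let definable_saturated : exists f : GRing.formula F,
  forall X, GRing.holds (point_env (qcoord X)) f <-> saturated_slice X.
Proof.
have defX a : mdefinable (fun e => X_of e a).
  move=> i j; have [t Ht] := definable_var F (arrow_entry i j).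
  by exists t => e; rewrite Ht ffunE mxE.
have defg x : mdefinable (fun e => g_of e x).
  move=> i j; have [t Ht] := definable_var F (n + vertex_entry i j).
  by exists t => e; rewrite Ht mxE.
(* The equation X = g.Y is written without inverses, as X g = g Y. *)
pose good e := (forall x, \det (g_of e x) <> 0) /\
  forall (a : qa Q) (i : 'I_(alpha (qt a))) (j : 'I_(alpha (qs a))),
    (X_of e a *m g_of e (qs a)) i j = (g_of e (qt a) *m (M + iota (V_of e)) a) i j.
have def_good : definable good.
  apply: definableI.
    apply: definable_all => x; apply: definable_neq; last exact: definable_const.
    exact: definable_det.
  do 3!apply: definable_all => ?; apply: definable_eq.
    by apply: mdefinableM.
  by apply: mdefinableM.
have [f Hf] := definable_ex (seq.iota n (n_g + n_V)) def_good.
exists f => X; rewrite Hf; split=> [[e eX [gU Xg]]|[g [V [gU XgV]]]].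
  have unit_g x : g_of e x \in unitmx by rewrite unitmxE unitfE; apply/eqP.
  have X_e : X_of e = X.
    apply: qcoord_inj => r; rewrite qrep_ofE -(point_env_nth (qcoord X) r).
    by apply: eX; rewrite mem_iota negb_and -ltnNge ltn_ord.
  exists (g_of e), (V_of e); split=> //; apply/ffunP=> a; rewrite ffunE -X_e.
  by apply: (canRL (mulmxK (unit_g _))); apply/matrixP.
pose eg := [seq base_coord g r | r <- enum 'I_n_g].
pose eV := [seq qcoord V r | r <- enum 'I_n_V].
have sz_g : size eg = n_g by rewrite size_map size_enum_ord.
have sz_V : size eV = n_V by rewrite size_map size_enum_ord.
exists (point_env (qcoord X) ++ eg ++ eV).
  move=> i; rewrite mem_iota negb_and -ltnNge -leqNgt nth_cat size_map size_enum_ord.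
  case: ltnP => // n_i i_large.
  have env_i : (size (point_env (qcoord X)) <= i)%N by rewrite size_map size_enum_ord.
  rewrite (nth_default _ env_i) nth_default //.
  by rewrite size_cat sz_g sz_V leq_subRL.
set e := _ ++ _.
have X_e : X_of e = X.
  apply: qcoord_inj => r; rewrite qrep_ofE nth_cat size_map size_enum_ord ltn_ord.
  exact: point_env_nth.
have g_e x : g_of e x = g x.
  rewrite -[RHS]base_coordK; apply/matrixP=> i j; rewrite !mxE.
  rewrite nth_cat size_map size_enum_ord ltnNge leq_addr /= addKn.
  by rewrite nth_cat sz_g ltn_ord (nth_map (vertex_entry i j)) ?nth_ord_enum ?size_enum_ord.
have V_e : V_of e = V.
  apply: qcoord_inj => r; rewrite qrep_ofE.
  rewrite nth_cat size_map size_enum_ord -addnA ltnNge leq_addr /= addKn.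
  rewrite nth_cat sz_g ltnNge leq_addr /= addKn.
  by rewrite (nth_map r) ?nth_ord_enum ?size_enum_ord.
split=> [x|a i j]; rewrite ?g_e ?X_e ?V_e.
  by apply/eqP; rewrite -unitfE -unitmxE.
by rewrite XgV ffunE mulmxKV.
Qed.

(** Since no nonzero polynomial vanishes on the saturated slice, the formula that
    defines it is not generically false, hence it is generically true. *)
Lemma saturated_slice_open : exists2 q : {mpoly F[#|coord_index alpha|]}, q != 0 &
  forall X, q.@[qcoord X] != 0 -> saturated_slice X.
Proof.
have [f Hf] := definable_saturated.
have [q q0 Hq] := definable_generic #|coord_index alpha| f.
exists q => // X qX; apply/Hf.
apply: contrapT => notX; move: q0 => /eqP[]; apply: saturated_slice_dense => Y /Hf fY.
apply/eqP/contraT=> qY; case: notX.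
exact: Hq fY.
Qed.

End OpenImage.

(** * The universal property of the fundamental algebra *)

Section AlgebraMorphisms.
Variable F : fieldType.

Lemma lrmorphism_of (A B : algType F) (f : A -> B) :
  linear f -> monoid_morphism f -> exists g : {lrmorphism A -> B}, g =1 f.
Proof.
move=> lf mf; pose g : {lrmorphism A -> B} := HB.pack f
  (GRing.isLinear.Build _ _ _ _ f lf) (GRing.isMonoidMorphism.Build _ _ f mf).
by exists g.
Qed.

Lemma lrmorphism_inv (A B : algType F) (f : {lrmorphism A -> B}) : bijective f ->
  exists g : {lrmorphism B -> A}, cancel f g /\ cancel g f.
Proof.
case=> f' fK f'K.
have [g gE] := lrmorphism_of (can2_linear fK f'K) (can2_monoid_morphism fK f'K).
by exists g; split=> x; rewrite gE ?fK ?f'K.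
Qed.

Variables (A : algType F) (S : {pred A}) (clS : subalg_closed S).

HB.instance Definition _ :=
  GRing.isSubalgClosed.Build F A S (GRing.subalg_closed_semi clS).

(** The type mentions the closure proof, so that its instances can depend on it. *)
Definition subalgebra := let _ := clS in {x : A | x \in S}.
HB.instance Definition _ := SubChoice.on subalgebra.
HB.instance Definition _ := [SubChoice_isSubAlgebra of subalgebra by <:].

Lemma subalgebra_incl : exists i : {lrmorphism subalgebra -> A}, i =1 val.
Proof. by apply: lrmorphism_of => //; split. Qed.

Lemma subalgebra_corestrict (B : algType F) (f : {lrmorphism B -> A}) :
  (forall x, f x \in S) -> exists g : {lrmorphism B -> subalgebra}, forall x, val (g x) = f x.
Proof.
move=> fS; pose g0 x : subalgebra := exist (fun x => x \in S) (f x) (fS x).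
have [||g gE] := @lrmorphism_of B subalgebra g0.
- by move=> c x y; apply: val_inj; rewrite /= linearP.
- by split=> [|x y]; apply: val_inj; rewrite /= ?rmorph1 ?rmorphM.
by exists g => x; rewrite gE.
Qed.

End AlgebraMorphisms.

Section SpanningTree.
Variables (F : fieldType) (S : separable_graph F) (T : {set g_E S}).

(** The order in which the amalgamated product meets the vertices: W is the set
    of the vertices reached so far and D the set of the edges used. *)
Inductive grown : {set g_V S} -> {set g_E S} -> Prop :=
| grown_start v : grown [set v] set0
| grown_step W D e b : grown W D -> e \in T -> g_end e b \in W ->
    g_end e (~~ b) \notin W -> grown (g_end e (~~ b) |: W) (e |: D).

Lemma grown_sub W D : grown W D -> D \subset T.
Proof.
elim=> [v|W' D' e b _ sub eT _ _]; first exact: sub0set.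
by rewrite subUset sub1set eT.
Qed.

Lemma grown_ends W D e b : grown W D -> e \in D -> g_end e b \in W.
Proof.
move=> gWD; elim: gWD b => [v|W' D' e' b' _ IH _ eb' _] b; first by rewrite in_set0.
rewrite !inE => /predU1P[->|/IH ->]; last by rewrite orbT.
by case: b b' eb' => -[] /= eb'; rewrite ?eb' ?eqxx ?orbT.
Qed.

Lemma adjacent_sym (D : {set g_E S}) : ssrbool.symmetric (adjacent D).
Proof.
suff H v w : adjacent D v w -> adjacent D w v by move=> v w; apply/idP/idP; apply: H.
case/exists_inP=> e eD /existsP[b /andP[v_e w_e]]; apply/exists_inP; exists e => //.
by apply/existsP; exists (~~ b); rewrite negbK v_e w_e.
Qed.

Lemma adjacent_mono (D1 D2 : {set g_E S}) v w : D1 \subset D2 ->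
  connect (adjacent D1) v w -> connect (adjacent D2) v w.
Proof.
move=> sub; apply: connect_sub => x y /exists_inP[e /(subsetP sub) eD xy].
by apply/connect1/exists_inP; exists e.
Qed.

Lemma grown_connected W D : grown W D ->
  forall v w, v \in W -> w \in W -> connect (adjacent D) v w.
Proof.
elim=> [v0|W' D' e b _ IH _ eb _] v w.
  by rewrite !inE => /eqP-> /eqP->.
have conn x : x \in g_end e (~~ b) |: W' -> connect (adjacent (e |: D')) (g_end e b) x.
  rewrite !inE => /predU1P[->|/(IH _ _ eb)]; last exact: adjacent_mono (subsetUr _ _).
  apply/connect1/exists_inP; exists e; first by rewrite setU11.
  by apply/existsP; exists b; rewrite !eqxx.
move=> /conn v_e /conn; apply: connect_trans.
by rewrite (sym_connect_sym (adjacent_sym _)).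
Qed.

(** An unused edge of the tree would join two vertices that are connected by the
    used ones, and close a circuit. *)
Lemma grown_all D : maximal_subtree T -> grown setT D -> D = T.
Proof.
move=> [_ acyclic] gD; apply/eqP; rewrite eqEsubset (grown_sub gD).
apply/subsetP=> e eT; apply: contraT => eD.
have /negP[] := acyclic e eT.
apply: adjacent_mono (grown_connected gD _ _); rewrite ?inE //.
by rewrite subsetD1 (grown_sub gD).
Qed.

End SpanningTree.

Section Universal.
Variables (F : fieldType) (S : separable_graph F) (T : {set g_E S}).

Definition tree_compatible (D : {set g_E S}) (Q : Type) (f : forall v, g_SV v -> Q) : Prop :=
  forall e s, e \in D -> f _ (g_emb e false s) = f _ (g_emb e true s).

Definition loop_compatible (D : {set g_E S}) (Q : algType F)
    (f : forall v, g_SV v -> Q) (t t' : g_E S -> Q) : Prop :=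
  forall e, e \in D -> [/\ t e * t' e = 1, t' e * t e = 1 &
    forall s, f _ (g_emb e true s) = t' e * f _ (g_emb e false s) * t e].

Definition tree_universal (W : {set g_V S}) (D : {set g_E S}) (A : algType F)
    (j : forall v, g_SV v -> A) : Prop :=
  [/\ tree_compatible D j,
      forall (Q : algType F) (f : forall v, {lrmorphism g_SV v -> Q}),
        tree_compatible D (fun v => f v : g_SV v -> Q) ->
        exists h : {lrmorphism A -> Q}, forall v s, v \in W -> h (j v s) = f v s
    & forall (Q : algType F) (h h' : {lrmorphism A -> Q}),
        (forall v s, v \in W -> h (j v s) = h' (j v s)) -> h =1 h'].

Definition tower_universal (D0 D : {set g_E S}) (A : algType F)
    (j : forall v, g_SV v -> A) (t t' : g_E S -> A) : Prop :=
  [/\ tree_compatible D0 j, loop_compatible D j t t',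
      forall (Q : algType F) (f : forall v, {lrmorphism g_SV v -> Q}) (u u' : g_E S -> Q),
        tree_compatible D0 (fun v => f v : g_SV v -> Q) ->
        loop_compatible D (fun v => f v : g_SV v -> Q) u u' ->
        exists h : {lrmorphism A -> Q}, (forall v s, h (j v s) = f v s) /\
          (forall e, e \in D -> h (t e) = u e /\ h (t' e) = u' e)
    & forall (Q : algType F) (h h' : {lrmorphism A -> Q}),
        (forall v s, h (j v s) = h' (j v s)) ->
        (forall e, e \in D -> h (t e) = h' (t e) /\ h (t' e) = h' (t' e)) -> h =1 h'].

(** Uniqueness passes through a step because two morphisms that agree on both
    factors of a pushout are both equal to the induced one. *)
Lemma tree_amalgam_universal W (A : algType F) (j : forall v, g_SV v -> A) :
  tree_amalgam T W j -> exists2 D, grown T W D & tree_universal W D j.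
Proof.
elim=> {W A j} [v A j f bij_f jf|W A j e b P f g j' _ [D gD [jD exA unA]] eT eb e'b].
  exists set0; first exact: grown_start.
  split=> [e s|Q f' _|Q h h' hh' x]; first by rewrite inE.
    have [f1 [fK f1K]] := lrmorphism_inv bij_f.
    pose h : {lrmorphism A -> Q} := f' v \o f1.
    exists h => w s; rewrite inE => /eqP wv; move: s; rewrite wv => s.
    by rewrite jf /= fK.
  have [f1 [fK f1K]] := lrmorphism_inv bij_f.
  by rewrite -(f1K x) -jf hh' ?inE.
move=> [fg univ] j'f j'g.
exists (e |: D); first exact: grown_step.
have compat (Q : Type) (f' : forall v, g_SV v -> Q) :
    tree_compatible (e |: D) f' <->
    tree_compatible D f' /\ forall s, f' _ (g_emb e b s) = f' _ (g_emb e (~~ b) s).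
  split=> [cf|[cfD cfe] e' s].
    split=> [e' s e'D|s]; first by apply: cf; rewrite inE e'D orbT.
    by case: (b); rewrite /= cf ?setU11.
  rewrite !inE => /predU1P[e'E|]; last exact: cfD.
  by move: s; rewrite e'E => s; have := cfe s; case: (b).
split.
- apply/compat; split=> [e' s e'D|s].
    by rewrite !j'f ?(grown_ends _ gD) // jD.
  by rewrite j'f // j'g fg.
- move=> Q f' /compat[f'D f'e]; have [hA hAj] := exA Q f' f'D.
  have [s|h [hf hg] _] := univ Q hA (f' _); first by rewrite hAj // f'e.
  exists h => v s; rewrite !inE => /predU1P[vE|vW]; last by rewrite j'f // hf hAj.
  by move: s; rewrite vE => s; rewrite j'g hg.
move=> Q h h' hh'.
pose hf : {lrmorphism A -> Q} := h' \o f.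
pose hg : {lrmorphism g_SV (g_end e (~~ b)) -> Q} := h' \o g.
have hfg s : hf (j _ (g_emb e b s)) = hg (g_emb e (~~ b) s) by rewrite /= fg.
have [h0 _ h0_un] := univ Q hf hg hfg.
have h'h0 : h' =1 h0 by apply: h0_un.
suff hh0 : h =1 h0 by move=> x; rewrite hh0 h'h0.
apply: h0_un => [x|y]; last by rewrite /= -j'g hh' ?setU11.
pose hf1 : {lrmorphism A -> Q} := h \o f.
apply: (unA Q hf1 hf) => v s vW /=.
by rewrite -j'f // hh' // inE vW orbT.
Qed.

Lemma hnn_tower_universal D (A : algType F) (j : forall v, g_SV v -> A) t t' :
  maximal_subtree T -> hnn_tower T D j t t' -> tower_universal T D j t t'.
Proof.
move=> treeT.
elim=> {D A j t t'} [A j t t' /tree_amalgam_universal[D0 gD0 [jD0 exA unA]]|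
    D A j t t' e P f j' u u' _ [jD0 jD exA unA] eT eD].
  rewrite (grown_all treeT gD0) in jD0 exA.
  split=> // [e|Q f u u' cf _|Q h h' hh' _]; first by rewrite inE.
    have [h hE] := exA Q f cf; exists h; split=> [v s|e]; last by rewrite inE.
    by rewrite hE ?inE.
  by apply: unA => v s _.
move=> [[tt' t't ft] univ] j'f uf.
split.
- by move=> e' s e'T; rewrite !j'f jD0.
- move=> e'; rewrite !inE => /predU1P[->|e'D].
    by split=> // s; rewrite !j'f ft.
  have [-> ->] := uf _ e'D; have [H1 H2 H3] := jD _ e'D.
  split=> [||s]; rewrite -?rmorphM ?H1 ?H2 ?rmorph1 //.
  by rewrite !j'f H3 !rmorphM.
- move=> Q f' w w' cf' lf'.
  have [|hA [hAj hAt]] := exA Q f' w w' cf'.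
    by move=> e' e'D; apply: lf'; rewrite inE e'D orbT.
  have [we w'e fe] := lf' e (setU11 _ _).
  have [//|//|s|h [hf ht ht'] _] := univ Q hA (w e) (w' e).
    by rewrite !hAj fe.
  exists h; split=> [v s|e']; first by rewrite j'f hf hAj.
  rewrite !inE => /predU1P[->|e'D] //.
  by have [-> ->] := uf _ e'D; rewrite !hf; apply: hAt.
move=> Q h h' hj ht.
pose hf : {lrmorphism A -> Q} := h' \o f.
have [he he'] := ht e (setU11 _ _).
have [||s|h0 _ h0_un] := univ Q hf (h' (u e)) (h' (u' e)).
- by rewrite -rmorphM tt' rmorph1.
- by rewrite -rmorphM t't rmorph1.
- by rewrite /= ft !rmorphM.
have h'h0 : h' =1 h0 by apply: h0_un.
suff hh0 : h =1 h0 by move=> x; rewrite hh0 h'h0.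
apply: h0_un => // x.
pose hf1 : {lrmorphism A -> Q} := h \o f.
apply: (unA Q hf1 hf) => [v s|e' e'D] /=; first by rewrite -j'f hj.
have [E1 E2] := uf _ e'D; rewrite -E1 -E2.
by apply: ht; rewrite inE e'D orbT.
Qed.

Variables (P : fundamental_algebra T) (treeT : maximal_subtree T).

Lemma pi1_universal : tower_universal T (~: T)
  (fun v => pi1_incl P v : g_SV v -> P) (pi1_t P) (pi1_tinv P).
Proof. exact: hnn_tower_universal treeT (pi1_tower P). Qed.

Lemma tree_grown : grown T setT T.
Proof.
have H D (B : algType F) (j : forall v, g_SV v -> B) u u' :
    hnn_tower T D j u u' -> grown T setT T.
  elim=> {D B j u u'} // B j _ _ /tree_amalgam_universal[D gD _].
  by have := gD; rewrite {1}(grown_all treeT gD).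
exact: H (pi1_tower P).
Qed.

(** The subalgebra has the universal property too, hence a retraction from P
    which uniqueness forces to be the identity. *)
Lemma pi1_generated (B : {pred P}) : subalg_closed B ->
  (forall v s, pi1_incl P v s \in B) ->
  (forall e, e \notin T -> pi1_t P e \in B /\ pi1_tinv P e \in B) ->
  forall x, x \in B.
Proof.
move=> clB BS Bt x; have [cT cL exP unP] := pi1_universal.
have [i iE] := subalgebra_incl clB.
have val_i y : val y = i y by rewrite iE.
have exf v := cid (subalgebra_corestrict (f := pi1_incl P v) clB (BS v)).
pose f v := sval (exf v); have fE v s : val (f v s) = pi1_incl P v s := svalP (exf v) s.
pose lift (y : P) (By : y \in B) : subalgebra clB := exist (fun x => x \in B) y By.
have sub_t (r : g_E S -> P) : (forall e, e \notin T -> r e \in B) ->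
    exists u : g_E S -> subalgebra clB, forall e, e \notin T -> val (u e) = r e.
  move=> rB; pose u e : subalgebra clB :=
    if pselect (e \notin T) is left eT then lift _ (rB e eT) else 0.
  by exists u => e eT; rewrite /u; case: pselect.
have [u uE] := sub_t _ (fun e eT => (Bt e eT).1).
have [u' u'E] := sub_t _ (fun e eT => (Bt e eT).2).
have [||h [hj ht]] := exP (subalgebra clB) f u u'.
- by move=> e s eT; apply: val_inj; rewrite !fE cT.
- move=> e eT; have [H1 H2 H3] := cL e eT; rewrite inE in eT.
  have iu : i (u e) = pi1_t P e by rewrite -val_i uE.
  have iu' : i (u' e) = pi1_tinv P e by rewrite -val_i u'E.
  have if_ v s : i (f v s) = pi1_incl P v s by rewrite -val_i fE.
  split=> [||s]; apply: val_inj; rewrite [LHS]val_i [RHS]val_i.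
  - by rewrite rmorphM rmorph1 /= iu iu'.
  - by rewrite rmorphM rmorph1 /= iu iu'.
  - by rewrite !rmorphM /= iu iu' !if_ H3.
pose ih : {lrmorphism P -> P} := i \o h.
have -> : x = ih x.
  have [idP idPE] : exists g : {lrmorphism P -> P}, g =1 id.
    by apply: lrmorphism_of; [move=> c y z | split].
  rewrite -[LHS]idPE; apply: unP => [v s|e eT]; rewrite !idPE /= -!val_i.
    by rewrite hj fE.
  by have [-> ->] := ht e eT; rewrite inE in eT; rewrite uE // u'E.
by rewrite /= -val_i; apply: valP.
Qed.

End Universal.

(** * Burnside's theorem *)

Section Burnside.
Variable F : closedFieldType.

(** A linear subspace that is only given as a property: a subspace of maximal
    dimension among those on which the property holds. *)
Lemma vspace_of_closed (V : vectType F) (Q : V -> Prop) : Q 0 ->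
  (forall c u v, Q u -> Q v -> Q (c *: u + v)) ->
  exists U : {vspace V}, forall u, u \in U <-> Q u.
Proof.
move=> Q0 Qlin.
pose inside d := `[< exists2 U : {vspace V}, \dim U = d & forall u, u \in U -> Q u >].
have ex_in : exists d, inside d.
  by exists 0%N; apply/asboolP; exists 0%VS; [rewrite dimv0 | move=> u; rewrite memv0 => /eqP->].
have in_le d : inside d -> (d <= \dim (fullv : {vspace V}))%N.
  by move/asboolP=> [U <- _]; apply: dimvS (subvf U).
case: (ex_maxnP ex_in in_le) => d /asboolP[U dimU UQ] max_d.
exists U => u; split=> [/UQ //|Qu]; apply: contraT => uU.
have : inside (\dim (U + <[u]>)%VS).
  apply/asboolP; exists (U + <[u]>)%VS => // x /memv_addP[v vU [w /vlineP[c ->] ->]].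
  by rewrite addrC; apply: Qlin => //; apply: UQ.
move/max_d; rewrite leqNgt => /negP[]; rewrite -dimU ltn_neqAle dimvS ?addvSl // andbT.
apply: contraNneq uU => E.
have /eqP -> : U == (U + <[u]>)%VS by rewrite eqEdim addvSl E leqnn.
by rewrite (subvP (addvSr _ _)) // memv_line.
Qed.

Variables (P : algType F) (n : nat) (rho : {lrmorphism P -> 'M[F]_n}).
Hypothesis irr : simple_rep rho.

Let rhoM p q : rho (p * q) = rho p *m rho q.
Proof. exact: rmorphM. Qed.

Lemma simple_closed (Q : 'cV[F]_n -> Prop) : Q 0 ->
  (forall c u v, Q u -> Q v -> Q (c *: u + v)) ->
  (forall p u, Q u -> Q (rho p *m u)) -> (exists2 u, Q u & u != 0) -> forall u, Q u.
Proof.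
move=> Q0 Qlin Qrho [u0 Qu0 u0n0]; have [U UQ] := vspace_of_closed Q0 Qlin.
have [|U0|Ufull] := irr.2 U.
- by move=> p u /UQ /(Qrho p) /UQ.
- by have := (UQ u0).2 Qu0; rewrite U0 memv0 (negPf u0n0).
- by move=> u; apply/UQ; rewrite Ufull memvf.
Qed.

Lemma simple_transitive (x y : 'cV[F]_n) : x != 0 -> exists p, rho p *m x = y.
Proof.
move=> x0; apply: (@simple_closed (fun y => exists p, rho p *m x = y)).
- by exists 0; rewrite rmorph0 mul0mx.
- move=> c _ _ [p <-] [q <-]; exists (c *: p + q).
  by rewrite linearP mulmxDl scalemxAl.
- by move=> p _ [q <-]; exists (p * q); rewrite rmorphM -mulmxA.
by exists x => //; exists 1; rewrite rmorph1 mul1mx.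
Qed.

(** If the orbit of the row x were contained in a proper subspace, then the column
    vectors that it annihilates would form a nonzero submodule, hence everything. *)
Lemma simple_transitive_row (x y : 'rV[F]_n) : x != 0 -> exists p, x *m rho p = y.
Proof.
move=> x0.
have [||U UQ] := @vspace_of_closed _ (fun y : 'rV[F]_n => exists p, x *m rho p = y).
- by exists 0; rewrite rmorph0 mulmx0.
- move=> c _ _ [p <-] [q <-]; exists (c *: p + q).
  by rewrite linearP mulmxDr scalemxAr.
apply/UQ; pose B := \matrix_(i < \dim U) (vbasis U)`_i.
have inB z : z \in U -> (z <= B)%MS.
  move=> /coord_vbasis ->; apply: summx_sub => i _; apply: scalemx_sub.
  by rewrite -(rowK (fun i : 'I_(\dim U) => (vbasis U)`_i) i) row_sub.
have Bin z : (z <= B)%MS -> z \in U.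
  move=> /submxP[w ->]; rewrite mulmx_sum_row; apply: memv_suml => i _.
  by rewrite rowK memvZ // vbasis_mem // mem_nth // size_tuple.
apply/Bin/submx_full; rewrite -cokermx_eq0; apply: contraT => /matrix0Pn[i0 [j0 nz]].
pose v := col j0 (cokermx B).
have v0 : v != 0.
  by apply: contraNneq nz => v0; have /colP/(_ i0) := v0; rewrite [LHS]mxE [RHS]mxE => ->.
have killed : forall u : 'cV[F]_n, forall p, x *m rho p *m u = 0.
  apply: (@simple_closed (fun u => forall p, x *m rho p *m u = 0)).
  - by move=> p; rewrite mulmx0.
  - by move=> c u w Hu Hw p; rewrite mulmxDr -scalemxAr Hu Hw scaler0 addr0.
  - by move=> q u Hu p; rewrite mulmxA -(mulmxA x) -rhoM Hu.
  - exists v => // p; have /inB/submxP[w ->] : x *m rho p \in U by apply/UQ; exists p.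
    by rewrite -mulmxA /v colE (mulmxA B) mulmx_coker mul0mx mulmx0.
case/eqP: x0; apply/rowP=> j.
have := killed (delta_mx j 0) 1; rewrite rmorph1 mulmx1 -colE => /colP/(_ 0).
by rewrite !mxE.
Qed.

(** Over an algebraically closed field K has an eigenvalue. *)
Lemma singular_shift r (K : 'M[F]_r) : (0 < r)%N ->
  exists a, (\rank (K - a%:M)%R < r)%N.
Proof.
move=> r0.
have /closed_rootP[a] : size (char_poly K) != 1%N by rewrite size_char_poly eqSS -lt0n.
rewrite -eigenvalue_root_char => /eigenvalueP[v vK v0]; exists a.
rewrite ltn_neqAle rank_leq_row andbT -/(row_free _) -kermx_eq0.
apply/rowV0Pn; exists v => //; apply/sub_kermxP.
by rewrite mulmxBr vK mul_mx_scalar subrr.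
Qed.

(** The rank of a nonzero T = rho p of rank at least 2 can be lowered: if
    T = C R is a full rank factorization, then T rho(q) T - a T = C (K - a) R
    for K = R rho(q) C, where q is chosen such that K is not scalar, and a is an
    eigenvalue of K. *)
Lemma simple_rank1 : exists q (u : 'cV[F]_n) (w : 'rV[F]_n),
  [/\ rho q = u *m w, u != 0 & w != 0].
Proof.
suff [q rk1] : exists q, \rank (rho q) = 1%N.
  have rk1E r (C : 'M[F]_(n, r)) (R : 'M[F]_(r, n)) : r = 1%N -> C *m R = rho q ->
      exists (u : 'cV[F]_n) (w : 'rV[F]_n), u *m w = rho q.
    by move=> r1 E; move: C R E; rewrite r1 => C R E; exists C, R.
  have [u [w uw]] := rk1E _ _ _ rk1 (mulmx_base (rho q)).
  exists q, u, w; split=> //; apply/eqP=> z; move: rk1.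
    by rewrite -uw z mul0mx mxrank0.
  by rewrite -uw z mulmx0 mxrank0.
suff lower r : forall p, \rank (rho p) = r.+1 -> exists q, \rank (rho q) = 1%N.
  case rk1: (\rank (rho 1)) => [|r]; last exact: lower rk1.
  have := irr.1; rewrite -{1}(mxrank1 F n) -[1%:M]/(1 : 'M[F]_n) -(rmorph1 rho).
  by rewrite rk1.
elim/ltn_ind: r => r IH p rkp.
have [r0|r_gt0] := posnP r; first by exists p; rewrite rkp r0.
pose T := rho p; have CR := mulmx_base T.
have C_full := col_base_full T; have R_free := row_base_free T.
move: (col_base T) (row_base T) CR C_full R_free => C R CR C_full R_free.
have rkT : \rank T = r.+1 := rkp.
have rk_gt0 : (0 < \rank T)%N by rewrite rkT.
have rk_gt1 : (1 < \rank T)%N by rewrite rkT ltnS.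
pose i0 := Ordinal rk_gt0; pose i1 := Ordinal rk_gt1.
have Ci0 : col i0 C != 0.
  apply/eqP=> z; have /row_fullP[L LC] := C_full.
  have := congr1 (fun K => (L *m K) i0 0) z; rewrite /= colE mulmxA LC mul1mx mulmx0 !mxE eqxx.
  by move/eqP; rewrite oner_eq0.
have /row_freeP[R' RR'] := R_free.
have [q Hq] := simple_transitive (R' *m delta_mx i1 0) Ci0.
pose K := R *m rho q *m C.
have Ki : K i1 i0 = 1.
  have : col i0 K = delta_mx i1 0.
    have -> : col i0 K = R *m (rho q *m col i0 C) by rewrite !colE !mulmxA.
    by rewrite Hq mulmxA RR' mul1mx.
  by move/colP/(_ i1); rewrite !mxE !eqxx.
have [a rka] := singular_shift K rk_gt0.
have E : rho (p * q * p - a *: p) = C *m (K - a%:M) *m R.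
  rewrite linearB linearZ /= !rhoM -/T mulmxBr mulmxBl mul_mx_scalar -scalemxAl CR.
  by rewrite /K -{1 2}CR !mulmxA.
have Ka0 : K - a%:M != 0.
  apply: contraTneq (oner_neq0 F) => /matrixP/(_ i1 i0).
  by rewrite [LHS]mxE Ki !mxE mulr0n subr0 => ->; rewrite eqxx.
have rkE : \rank (rho (p * q * p - a *: p)%R) = \rank (K - a%:M)%R.
  by rewrite E mxrankMfree // eqmxMfull.
have [s sE] : exists s, \rank (K - a%:M)%R = s.+1.
  by exists (\rank (K - a%:M)%R).-1; rewrite prednK // lt0n mxrank_eq0.
apply: (IH s _ (p * q * p - a *: p)); last by rewrite rkE.
by rewrite -ltnS -sE -rkT.
Qed.

(** By transitivity on rows and columns, a single element u w of rank 1 yields all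
    the matrices of rank 1. *)
Lemma simple_surjective (A : 'M[F]_n) : exists p, rho p = A.
Proof.
have [q [u [w [qE u0 w0]]]] := simple_rank1.
have col_in i : exists p, rho p = col i A *m delta_mx 0 i.
  have [p1 H1] := simple_transitive (col i A) u0.
  have [p2 H2] := simple_transitive_row (delta_mx 0 i) w0.
  exists (p1 * q * p2); rewrite !rhoM qE.
  by rewrite mulmxA H1 -mulmxA H2.
have -> : A = \sum_i col i A *m delta_mx 0 i.
  apply/matrixP=> i j; rewrite summxE (bigD1 j) //= big1 => [|k /negPf kj].
    by rewrite addr0 !mxE big_ord1 !mxE !eqxx mulr1.
  by rewrite !mxE big_ord1 !mxE [j == k]eq_sym kj andbF mulr0.
elim: (index_enum _) => [|i s [p Hp]]; first by exists 0; rewrite rmorph0 big_nil.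
have [pi Hi] := col_in i; exists (pi + p).
by rewrite rmorphD /= Hi Hp big_cons.
Qed.

End Burnside.

(** * Representations with prescribed edge matrices *)

Section Twist.
Variables (F : closedFieldType) (S : separable_graph F) (T : {set g_E S}).
Variables (P : fundamental_algebra T) (treeT : maximal_subtree T).

Lemma conj_lrmorphism m (A : algType F) (f : {lrmorphism A -> 'M[F]_m.+1}) (g : 'M[F]_m.+1) :
  g \in unitmx ->
  exists h : {lrmorphism A -> 'M[F]_m.+1}, forall s, h s = invmx g *m f s *m g.
Proof.
move=> gU; apply: (@lrmorphism_of F A 'M[F]_m.+1 (fun s => invmx g *m f s *m g)).
  move=> c x y; rewrite linearP mulmxDr mulmxDl -scalemxAr -scalemxAl //.
split=> [|x y]; first by rewrite rmorph1 mulmx1 mulVmx.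
rewrite rmorphM -[RHS]/(_ *m _) -[f x * f y]/(f x *m f y).
by rewrite !mulmxA mulmxK.
Qed.

(** A new representation from an old one: the action of S_v is conjugated by g v
    and the inverse of the stable letter of e acts by t' e. *)
Lemma twisted_rep n (rho : {lrmorphism P -> 'M[F]_n}) (g : g_V S -> 'M[F]_n)
    (t' : g_E S -> 'M[F]_n) : (0 < n)%N ->
  (forall v, g v \in unitmx) -> (forall e, t' e \in unitmx) ->
  (forall e s, e \in T ->
     invmx (g (g_end e false)) *m rho (pi1_incl P _ (g_emb e false s)) *m g (g_end e false) =
     invmx (g (g_end e true)) *m rho (pi1_incl P _ (g_emb e true s)) *m g (g_end e true)) ->
  (forall e s, e \notin T ->
     invmx (g (g_end e true)) *m rho (pi1_incl P _ (g_emb e true s)) *m g (g_end e true) *m t' e =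
     t' e *m (invmx (g (g_end e false)) *m rho (pi1_incl P _ (g_emb e false s)) *m g (g_end e false))) ->
  exists h : {lrmorphism P -> 'M[F]_n},
    (forall v s, h (pi1_incl P v s) = invmx (g v) *m rho (pi1_incl P v s) *m g v) /\
    (forall e, e \notin T -> h (pi1_t P e) = invmx (t' e) /\ h (pi1_tinv P e) = t' e).
Proof.
case: n rho g t' => [//|m] rho g t' _ gU tU cT cL.
have [_ _ exP _] := pi1_universal P treeT.
have exf v : exists h : {lrmorphism g_SV v -> 'M[F]_m.+1},
    forall s, h s = invmx (g v) *m rho (pi1_incl P v s) *m g v.
  exact: (@conj_lrmorphism m _ (rho \o pi1_incl P v) (g v) (gU v)).
pose f v := sval (cid (exf v)).
have fE v s : f v s = invmx (g v) *m rho (pi1_incl P v s) *m g v := svalP (cid (exf v)) s.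
have [||h [hj ht]] := exP 'M[F]_m.+1 f (fun e => invmx (t' e)) t'.
- by move=> e s eT; rewrite !fE cT.
- move=> e; rewrite inE => eT; split=> [||s].
  + exact: mulVmx.
  + exact: mulmxV.
  + by rewrite !fE -[RHS]/(_ *m _ *m _) -cL // mulmxK.
exists h; split=> [v s|e eT]; first by rewrite hj fE.
by apply: ht; rewrite inE.
Qed.

End Twist.

Section Schur.
Variables (F : fieldType) (A : separable_algebra F).

(** Schur's lemma for S_k and S_k': some element acts by 1 on one and by 0 on the
    other. *)
Lemma simple_hom_eq0 (k k' : 'I_(sa_n A)) (B : 'M[F]_(sa_d k', sa_d k)) :
  k != k' -> (forall s, B *m sa_simple k s = sa_simple k' s *m B) -> B = 0.
Proof.
move=> kk' homB; have [s [sE _]] := @sa_wedderburn _ A (fun i => (i == k)%:R%:M).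
have := homB s; rewrite !sE eqxx eq_sym (negPf kk') mulmx1 => ->.
by rewrite mul_scalar_mx scale0r.
Qed.

(** An endomorphism commutes with all the matrix units; the one in column i0 and
    row y gives column y of B. *)
Lemma simple_end_scalar (k : 'I_(sa_n A)) (B : 'M[F]_(sa_d k)) (i0 : 'I_(sa_d k)) :
  (forall s, B *m sa_simple k s = sa_simple k s *m B) -> B = (B i0 i0)%:M.
Proof.
move=> homB; apply/matrixP=> x y; rewrite [RHS]mxE.
have [s [sE _]] := @sa_wedderburn _ A
  (fun i => \matrix_(x', y') ((x' == y :> nat) && (y' == i0 :> nat))%:R).
have /matrixP/(_ x i0) := homB s; rewrite sE !mxE.
rewrite (bigD1 y) //= big1 => [|z /negPf zy]; last by rewrite mxE val_eqE zy mulr0.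
rewrite mxE !eqxx mulr1 addr0 (bigD1 i0) //= big1 => [|z /negPf zi]; last first.
  by rewrite mxE !val_eqE zi andbF mul0r.
by rewrite mxE eqxx andbT addr0 => ->; rewrite mulr_natl.
Qed.

End Schur.

Section EdgeMatrix.
Variables (F : closedFieldType) (S : separable_graph F) (T : {set g_E S}).
Variables (P : fundamental_algebra T) (treeT : maximal_subtree T).
Variables (alpha : dimvec (zariski_quiver S)) (N : pi1_rep P alpha).
Let n := pr_dim N.

(** A copy of a simple S_e-module in N: a copy of V_i in the restriction of N to
    the algebra at the end b of e, and a copy of a simple S_e-module in V_i. *)
Definition edge_summand (e : g_E S) (b : bool) : finType :=
  {x : {i : 'I_(sa_n (g_SV (g_end e b))) & 'I_(alpha (mu i))} &
     {k : 'I_(sa_n (g_SE e)) & 'I_(g_mult k (tag x))}}.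

Definition summand_type e b (z : edge_summand e b) : 'I_(sa_n (g_SE e)) := tag (tagged z).

Definition summand_inc e b (z : edge_summand e b) : 'M[F]_(n, sa_d (summand_type z)) :=
  inc (pr_dec N (g_end e b)) (tag z) *m inc (g_res (tag (tag z))) (tagged z).

Definition summand_prj e b (z : edge_summand e b) : 'M[F]_(sa_d (summand_type z), n) :=
  prj (g_res (tag (tag z))) (tagged z) *m prj (pr_dec N (g_end e b)) (tag z).

Lemma summand_inc_hom e b (z : edge_summand e b) s :
  N (pi1_incl P _ (g_emb e b s)) *m summand_inc z =
  summand_inc z *m sa_simple (summand_type z) s.
Proof.
have /= H1 := inc_hom (pr_dec N (g_end e b)) (tag z) (g_emb e b s).
have /= H2 := inc_hom (g_res (tag (tag z))) (tagged z) s.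
by rewrite /summand_inc mulmxA H1 -!mulmxA H2.
Qed.

Lemma summand_prj_hom e b (z : edge_summand e b) s :
  summand_prj z *m N (pi1_incl P _ (g_emb e b s)) =
  sa_simple (summand_type z) s *m summand_prj z.
Proof.
have /= H1 := prj_hom (pr_dec N (g_end e b)) (tag z) (g_emb e b s).
have /= H2 := prj_hom (g_res (tag (tag z))) (tagged z) s.
by rewrite /summand_prj -mulmxA H1 !mulmxA H2.
Qed.

Lemma summand_prj_inc e b (z : edge_summand e b) :
  summand_prj z *m summand_inc z = 1%:M.
Proof.
rewrite /summand_prj /summand_inc mulmxA -(mulmxA (prj _ _)) prj_inc mulmx1.
exact: prj_inc.
Qed.

Lemma summand_prj_inc0 e b (z z' : edge_summand e b) :
  z != z' -> summand_prj z *m summand_inc z' = 0.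
Proof.
case: z z' => [x y] [x' y'] zz'; rewrite /summand_prj /summand_inc /=.
rewrite mulmxA -(mulmxA (prj _ _)).
have [xx'|xx'] := eqVneq x x'; last by rewrite prj_inc0 // mulmx0 mul0mx.
move: y' zz'; rewrite -xx' => y' zz'; rewrite prj_inc mulmx1 prj_inc0 //.
by apply: contraNneq zz' => /= ->.
Qed.

Lemma summand_sum e b : \sum_(z : edge_summand e b) summand_inc z *m summand_prj z = 1%:M.
Proof.
rewrite -(sum_inc_prj (pr_dec N (g_end e b))).
rewrite (eq_bigr (fun x => \sum_y inc (pr_dec N (g_end e b)) x *m
    (inc (g_res (tag x)) y *m prj (g_res (tag x)) y) *m prj (pr_dec N (g_end e b)) x)); last first.
  by move=> x _; rewrite -mulmx_suml -mulmx_sumr sum_inc_prj mulmx1.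
rewrite sig_big_dep /=; apply: eq_bigr => z _.
by rewrite /summand_inc /summand_prj !mulmxA.
Qed.

Definition source_summand e (a : edge_arrow e) (x : 'I_(alpha (mu (tag a).1.1))) :
    edge_summand e false :=
  existT _ (vertex_copy x) (edge_copy (tagged a).1).

Definition target_summand e (a : edge_arrow e) (y : 'I_(alpha (mu (tag a).1.2))) :
    edge_summand e true :=
  existT _ (vertex_copy y) (edge_copy (tagged a).2).

Definition edge_coef (X : qrep F alpha) e (a : edge_arrow e)
    (y : 'I_(alpha (mu (tag a).1.2))) (x : 'I_(alpha (mu (tag a).1.1))) : F :=
  X (Tagged (@edge_arrow F S) a : qa (zariski_quiver S)) y x.

Definition edge_block e (B : 'M[F]_n) (a : edge_arrow e)
    (y : 'I_(alpha (mu (tag a).1.2))) (x : 'I_(alpha (mu (tag a).1.1))) :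
    'M[F]_(sa_d (tag a).2) :=
  summand_prj (target_summand y) *m B *m summand_inc (source_summand x).

(** The S_e-linear map whose matrix in the chosen bases is the restriction of X
    to Q_e. *)
Definition edge_mx (X : qrep F alpha) e : 'M[F]_n :=
  \sum_(a : edge_arrow e) \sum_y \sum_x
    @edge_coef X e a y x *: 
      ((summand_inc (target_summand y) : 'M[F]_(n, sa_d (tag a).2)) *m
       (summand_prj (source_summand x) : 'M[F]_(sa_d (tag a).2, n))).


Lemma edge_arrow_eq (e : g_E S) (a a0 : edge_arrow e) : tag a = tag a0 ->
  (tagged a).1 = (tagged a0).1 :> nat -> (tagged a).2 = (tagged a0).2 :> nat -> a = a0.
Proof.
case: a a0 => [t [p q]] [t0 [p0 q0]] /= tt0; move: p q; rewrite tt0 => p q pp0 qq0.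
by congr existT; congr pair; apply: val_inj.
Qed.

Lemma summands_inj (e : g_E S) (a a0 : edge_arrow e) x x0 y y0 :
  @source_summand e a x = @source_summand e a0 x0 ->
  @target_summand e a y = @target_summand e a0 y0 ->
  a = a0.
Proof.
move=> Es Et; apply: edge_arrow_eq.
- have := congr1 (fun z => tag (tag z)) Es; have := congr1 (fun z => tag (tag z)) Et.
  have := congr1 (fun z => tag (tagged z)) Et => /=.
  by case: (tag a) (tag a0) => [[i j] k] [[i0 j0] k0] /= -> -> ->.
- exact: (congr1 (fun z : edge_summand e false => nat_of_ord (tagged (tagged z))) Es).
- exact: (congr1 (fun z : edge_summand e true => nat_of_ord (tagged (tagged z))) Et).
Qed.

Lemma source_summand_inj (e : g_E S) (a : edge_arrow e) : injective (@source_summand e a).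
Proof.
move=> x x' E; apply: val_inj.
exact: (congr1 (fun z : edge_summand e false => nat_of_ord (tagged (tag z))) E).
Qed.

Lemma target_summand_inj (e : g_E S) (a : edge_arrow e) : injective (@target_summand e a).
Proof.
move=> x x' E; apply: val_inj.
exact: (congr1 (fun z : edge_summand e true => nat_of_ord (tagged (tag z))) E).
Qed.

Lemma edge_block_mx X (e : g_E S) (a : edge_arrow e) y x :
  edge_block (edge_mx X e) y x = (@edge_coef X e a y x)%:M.
Proof.
have term a' y' x' :
    summand_prj (@target_summand e a y) *m
      (@edge_coef X e a' y' x' *:
        ((summand_inc (target_summand y') : 'M[F]_(n, sa_d (tag a').2)) *m
         (summand_prj (source_summand x') : 'M[F]_(sa_d (tag a').2, n)))) *m
      summand_inc (@source_summand e a x) =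
    @edge_coef X e a' y' x' *:
      ((summand_prj (@target_summand e a y) *m (summand_inc (target_summand y') : 'M[F]_(n, sa_d (tag a').2))) *m
       ((summand_prj (source_summand x') : 'M[F]_(sa_d (tag a').2, n)) *m summand_inc (@source_summand e a x))).
  by rewrite -scalemxAr -scalemxAl !mulmxA.
have zero_t a' y' : @target_summand e a y != @target_summand e a' y' ->
    summand_prj (@target_summand e a y) *m
      (summand_inc (target_summand y') : 'M[F]_(n, sa_d (tag a').2)) = 0.
  exact: summand_prj_inc0.
have zero_s a' x' : @source_summand e a' x' != @source_summand e a x ->
    (summand_prj (source_summand x') : 'M[F]_(sa_d (tag a').2, n)) *m
      summand_inc (@source_summand e a x) = 0.
  exact: summand_prj_inc0.
rewrite /edge_block /edge_mx mulmx_sumr mulmx_suml (bigD1 a) //= [X in _ + X]big1 => [|a' a'a].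
  rewrite addr0 mulmx_sumr mulmx_suml (bigD1 y) //= [X in _ + X]big1 => [|y' y'y].
    rewrite addr0 mulmx_sumr mulmx_suml (bigD1 x) //= [X in _ + X]big1 => [|x' x'x].
      rewrite addr0 term summand_prj_inc (summand_prj_inc (source_summand x)).
      by rewrite mulmx1 scalemx1.
    rewrite term zero_s ?mulmx0 ?scaler0 //.
    by rewrite (inj_eq (@source_summand_inj e a)).
  rewrite mulmx_sumr mulmx_suml big1 // => x' _.
  rewrite term zero_t ?mul0mx ?scaler0 //.
  by rewrite (inj_eq (@target_summand_inj e a)) eq_sym.
rewrite mulmx_sumr mulmx_suml big1 // => y' _.
rewrite mulmx_sumr mulmx_suml big1 // => x' _; rewrite term.
have [Et|Et] := eqVneq (target_summand y) (target_summand y'); last first.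
  by rewrite zero_t // mul0mx scaler0.
rewrite zero_s ?mulmx0 ?scaler0 //.
by apply: contraNneq a'a => Es; apply/eqP/(summands_inj Es (esym Et)).
Qed.

Definition edge_hom e (B : 'M[F]_n) : Prop := forall s,
  B *m N (pi1_incl P _ (g_emb e false s)) = N (pi1_incl P _ (g_emb e true s)) *m B.

Lemma edge_mx_hom X e : edge_hom e (edge_mx X e).
Proof.
move=> s; rewrite /edge_mx !mulmx_suml !mulmx_sumr; apply: eq_bigr => a _.
rewrite !mulmx_suml !mulmx_sumr; apply: eq_bigr => y _.
rewrite !mulmx_suml !mulmx_sumr; apply: eq_bigr => x _.
rewrite -scalemxAl -scalemxAr; congr (_ *: _).
pose I : 'M[F]_(n, sa_d (tag a).2) := summand_inc (target_summand y).
pose J : 'M[F]_(sa_d (tag a).2, n) := summand_prj (source_summand x).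
have HJ : J *m N (pi1_incl P _ (g_emb e false s)) = sa_simple (tag a).2 s *m J.
  exact: (summand_prj_hom (source_summand x) s).
have HI : N (pi1_incl P _ (g_emb e true s)) *m I = I *m sa_simple (tag a).2 s.
  exact: (summand_inc_hom (target_summand y) s).
rewrite -/I -/J; move: I J HI HJ => I J HI HJ.
by rewrite -mulmxA HJ !mulmxA HI.
Qed.

(** By Schur's lemma the blocks between summands that are not isomorphic vanish,
    and the other blocks are indexed by the arrows of Q_e. *)
Lemma edge_hom_eq0 (e : g_E S) (B : 'M[F]_n) : edge_hom e B ->
  (forall (a : edge_arrow e) y x, @edge_block e B a y x = 0) -> B = 0.
Proof.
move=> homB B0.
have -> : B = (\sum_(z : edge_summand e true) summand_inc z *m summand_prj z) *m B *m
    (\sum_(z : edge_summand e false) summand_inc z *m summand_prj z).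
  by rewrite !summand_sum mul1mx mulmx1.
rewrite !mulmx_suml big1 // => z' _; rewrite mulmx_sumr big1 // => z _.
suff E : summand_prj z' *m B *m summand_inc z = 0.
  have assoc p q (I' : 'M[F]_(n, p)) (J' : 'M_(p, n)) (I : 'M_(n, q)) (J : 'M_(q, n)) :
    I' *m J' *m B *m (I *m J) = I' *m (J' *m B *m I) *m J by rewrite !mulmxA.
  by rewrite assoc E mulmx0 mul0mx.
have [kk'|kk'] := eqVneq (summand_type z) (summand_type z'); last first.
  apply: (simple_hom_eq0 kk') => s.
  have HI := summand_inc_hom z s; have HJ := summand_prj_hom z' s.
  move: (summand_inc z) (summand_prj z') HI HJ => I J HI HJ.
  by rewrite -(mulmxA _ I) -HI mulmxA -(mulmxA J) homB mulmxA HJ !mulmxA.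
case: z z' kk' => [[i x] [k p]] [[j y] [k' q]]; rewrite /summand_type /= => kk'.
move: q; rewrite -kk' => q.
pose a : edge_arrow e := tagged (arrow p q).
exact: (B0 a y x).
Qed.

Lemma edge_iso_hom e : edge_hom e (edge_iso N e).
Proof.
have [cT cL _ _] := pi1_universal P treeT.
move=> s; rewrite /edge_iso; case: ifP => [eT|/negbT eT].
  by rewrite mul1mx mulmx1 cT.
have [|tt' _ ts] := cL e; first by rewrite inE.
have -> : N (pi1_incl P _ (g_emb e true s)) =
    N (pi1_tinv P e) *m N (pi1_incl P _ (g_emb e false s)) *m N (pi1_t P e).
  by rewrite (ts s) !rmorphM.
have tN : N (pi1_t P e) *m N (pi1_tinv P e) = 1%:M by rewrite -[LHS]rmorphM tt' rmorph1.
by rewrite -(mulmxA _ (N (pi1_t P e))) tN mulmx1.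
Qed.

Lemma edge_block_hom e (B : 'M[F]_n) (a : edge_arrow e) y x s : edge_hom e B ->
  @edge_block e B a y x *m sa_simple (tag a).2 s = sa_simple (tag a).2 s *m @edge_block e B a y x.
Proof.
move=> homB; rewrite /edge_block.
pose I : 'M[F]_(n, sa_d (tag a).2) := summand_inc (source_summand x).
pose J : 'M[F]_(sa_d (tag a).2, n) := summand_prj (target_summand y).
have HI : N (pi1_incl P _ (g_emb e false s)) *m I = I *m sa_simple (tag a).2 s.
  exact: (summand_inc_hom (source_summand x) s).
have HJ : J *m N (pi1_incl P _ (g_emb e true s)) = sa_simple (tag a).2 s *m J.
  exact: (summand_prj_hom (target_summand y) s).
rewrite -/I -/J; move: I J HI HJ => I J HI HJ.
by rewrite -(mulmxA _ I) -HI mulmxA -(mulmxA J) homB mulmxA HJ !mulmxA.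
Qed.

(** The point of N: its coordinates are the scalars by which the edge
    isomorphisms act between the isomorphic summands. *)
Lemma quiver_point_exists : exists X : qrep F alpha, forall e, edge_mx X e = edge_iso N e.
Proof.
pose i0 (e : g_E S) (a : edge_arrow e) : 'I_(sa_d (tag a).2) := Ordinal (sa_d_gt0 (tag a).2).
pose X : qrep F alpha := [ffun a : qa (zariski_quiver S) =>
  \matrix_(y, x) @edge_block (tag a) (edge_iso N (tag a)) (tagged a) y x (i0 _ (tagged a)) (i0 _ (tagged a))].
exists X => e; apply/eqP; rewrite -subr_eq0; apply/eqP/(@edge_hom_eq0 e) => [s|a y x].
  by rewrite mulmxBl mulmxBr edge_mx_hom edge_iso_hom.
have -> : edge_block (edge_mx X e - edge_iso N e) y x =
    edge_block (edge_mx X e) y x - edge_block (edge_iso N e) y x.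
  by rewrite /edge_block mulmxBr mulmxBl.
rewrite edge_block_mx /edge_coef ffunE mxE -(simple_end_scalar (i0 _ a)) ?subrr // => s.
exact/edge_block_hom/edge_iso_hom.
Qed.

End EdgeMatrix.

(** * Density of the simple locus *)

Section LinesAndSurjections.
Variables (F : closedFieldType).

Lemma surjective_simple (A : Type) n (rho : A -> 'M[F]_n) : (0 < n)%N ->
  (forall B, exists p, rho p = B) -> simple_rep rho.
Proof.
move=> n_gt0 surj; split=> // U U_stable.
have [U0|Un0] := eqVneq U 0%VS; [by left | right].
have uU := memv_pick U; have : vpick U != 0 by rewrite vpick0.
move: (vpick U) uU => u uU /matrix0Pn[i [j]]; rewrite (ord1 j) => uij.
apply/vspaceP=> w; rewrite memvf.
have [p rho_p] := surj ((u i 0)^-1 *: (w *m delta_mx 0 i)).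
have <- : rho p *m u = w; last exact: U_stable.
rewrite rho_p -scalemxAl -mulmxA.
have -> : delta_mx 0 i *m u = (u i 0)%:M.
  by rewrite -rowE [row i u]mx11_scalar mxE.
by rewrite mul_mx_scalar scalerA mulVf // scale1r.
Qed.

Lemma mpoly_line n (p : {mpoly F[n]}) (x z : 'I_n -> F) :
  exists D : {poly F}, forall t, D.[t] = p.@[fun i => x i + t * z i].
Proof.
exists (\sum_(m <- msupp p) p@_m *: \prod_i ((x i)%:P + z i *: 'X) ^+ m i) => t.
rewrite mevalE horner_sum; apply: eq_bigr => m _; rewrite hornerZ horner_prod.
congr (_ * _); apply: eq_bigr => i _.
by rewrite horner_exp hornerD hornerC hornerZ hornerX mulrC.
Qed.

End LinesAndSurjections.

Section Deformation.
Variables (F : closedFieldType) (S : separable_graph F) (T : {set g_E S}).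
Variables (P : fundamental_algebra T) (treeT : maximal_subtree T).
Variables (alpha : dimvec (zariski_quiver S)) (N : pi1_rep P alpha).
Let n := pr_dim N.

(** A solution g of phi e = g w (g v)^-1 for the edges e : v -> w of the tree, in
    which each new vertex is reached through one edge and so determines its g. *)
Lemma potentials W D (phi : g_E S -> F -> 'M[F]_n) : grown T W D ->
  (forall e, mregular (phi e)) -> (forall e, e \in T -> phi e 0 = 1%:M) ->
  exists g : g_V S -> F -> 'M[F]_n,
    [/\ forall v, mregular (g v), forall v, g v 0 = 1%:M &
        forall t, (forall e, phi e t \in unitmx) ->
          (forall v, g v t \in unitmx) /\
          (forall e, e \in D -> phi e t *m g (g_end e false) t = g (g_end e true) t)].
Proof.
move=> gD phi_reg phi0; elim: gD => [v|W' D' e b gD [g [g_reg g0 gE]] eT eb e'b].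
  exists (fun _ _ => 1%:M); split=> // [v' i j|t phiU]; first exact: regular_const.
  by split=> [v'|e]; rewrite ?unitmx1 ?inE.
pose gw t := if b then invmx (phi e t) *m g (g_end e b) t else phi e t *m g (g_end e b) t.
pose w := g_end e (~~ b).
exists (fun v t => if v == w then gw t else g v t); split=> [v|v|t phiU].
- case: (v == w) => //; rewrite /gw; case: (b).
    by apply: mregularM => //; apply: mregularV; rewrite ?phi0 ?unitmx1.
  exact: mregularM.
- case: (v == w) => //; rewrite /gw !g0 phi0 //.
  by rewrite invmx1 mulmx1; case: (b).
have [gU geq] := gE t phiU.
split=> [v|e1].
  case: (v == w) => //; rewrite /gw; case: (b).
    by rewrite unitmx_mul unitmx_inv phiU gU.
  by rewrite unitmx_mul phiU gU.
rewrite !inE => /predU1P[->|e1D]; last first.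
  have notw b1 : (g_end e1 b1 == w) = false.
    by apply: contraNF e'b => /eqP E; rewrite -/w -E (grown_ends _ gD).
  by rewrite !notw geq.
have bw : (g_end e b == w) = false by apply: contraNF e'b => /eqP E; rewrite -/w -E.
rewrite /gw; case: b @w @gw eb e'b bw => w gw eb e'b bw; rewrite /w /= eqxx bw.
  by rewrite mulKVmx.
by [].
Qed.

Section Twisted.
Variables (X : qrep F alpha) (g : g_V S -> 'M[F]_n).

Definition twisted_edge e : 'M[F]_n :=
  invmx (g (g_end e true)) *m edge_mx N X e *m g (g_end e false).

(** h is the representation with point X on the same space as N, where the
    adapted bases of N at the vertex v are transported by g v. *)
Definition twists (h : P -> 'M[F]_n) : Prop :=
  (forall v s, h (pi1_incl P v s) = invmx (g v) *m N (pi1_incl P v s) *m g v) /\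
  (forall e, e \notin T -> h (pi1_t P e) = invmx (twisted_edge e) /\
                           h (pi1_tinv P e) = twisted_edge e).

Hypotheses (gU : forall v, g v \in unitmx) (XU : forall e, edge_mx N X e \in unitmx).
Hypothesis gT : forall e, e \in T -> edge_mx N X e *m g (g_end e false) = g (g_end e true).

Lemma twists_exist : (0 < n)%N -> exists h : {lrmorphism P -> 'M[F]_n}, twists h.
Proof.
move=> n_gt0; apply: twisted_rep => // [e|e s eT|e s eT].
- by rewrite /twisted_edge !unitmx_mul unitmx_inv !gU XU.
- have hom := edge_mx_hom N X (e := e) s.
  rewrite -[RHS]mulmxA; apply: (canRL (mulKmx (gU _))).
  by rewrite -(gT eT) !mulmxA mulmxK // hom.
- have hom := edge_mx_hom N X (e := e) s.
  rewrite /twisted_edge !mulmxA !mulmxK //.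
  by rewrite -(mulmxA _ _ (edge_mx N X e)) -hom !mulmxA.
Qed.

(** Transparent, because the point of the twisted representation is computed from
    its inclusions and projections. *)
Definition twisted_decomposition (A : Type) (rho rho' : A -> 'M[F]_n) (I : finType)
    (d : I -> nat) (sigma : forall i, A -> 'M[F]_(d i)) (m : I -> nat) (c : 'M[F]_n)
    (cU : c \in unitmx) (E : forall s, rho' s = invmx c *m rho s *m c)
    (D : decomposition rho sigma m) : decomposition rho' sigma m.
Proof.
exists (fun x => invmx c *m inc D x) (fun x => prj D x *m c).
- by move=> x s; rewrite E -!mulmxA mulKVmx // inc_hom.
- by move=> x s; rewrite E !mulmxA mulmxK // prj_hom.
- by move=> x; rewrite mulmxA mulmxK // prj_inc.
- by move=> x y xy; rewrite mulmxA mulmxK // prj_inc0.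
have -> : 1%:M = invmx c *m (\sum_x inc D x *m prj D x) *m c.
  by rewrite sum_inc_prj mulmx1 mulVmx.
rewrite mulmx_sumr mulmx_suml.
by apply: eq_bigr => x _; rewrite !mulmxA.
Defined.

Lemma twists_point (h : {lrmorphism P -> 'M[F]_n}) : twists h ->
  exists2 N' : pi1_rep P alpha, quiver_point N' X & (simple_rep h -> simple_rep N').
Proof.
move=> [hS ht].
pose dec v := twisted_decomposition (gU v) (hS v) (pr_dec N v).
pose N' := Pi1Rep dec; exists N' => // e i j k p q x y.
have -> : edge_iso N' e = twisted_edge e.
  rewrite /edge_iso; case: ifP => [eT|/negbT eT]; last by have [_ ->] := ht e eT.
  by rewrite /twisted_edge -mulmxA gT // mulVmx.
pose a : edge_arrow e := tagged (arrow p q).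
refine (etrans _ (@edge_block_mx _ _ _ _ _ N X e a y x)).
rewrite /edge_block /summand_prj /summand_inc /=.
rewrite /twisted_edge !mulmxA mulmxK // -!mulmxA mulKVmx //.
Qed.

End Twisted.


Lemma pi1_t_inverse e : e \notin T ->
  N (pi1_tinv P e) \in unitmx /\ invmx (N (pi1_tinv P e)) = N (pi1_t P e).
Proof.
move=> eT; have [_ cL _ _] := pi1_universal P treeT.
have [|_ t't _] := cL e; first by rewrite inE.
have tN : N (pi1_tinv P e) *m N (pi1_t P e) = 1%:M by rewrite -[LHS]rmorphM t't rmorph1.
have [tU _] := mulmx1_unit tN; split=> //.
by rewrite -[LHS]mulmx1 -tN mulKmx.
Qed.

Lemma edge_iso_unit e : edge_iso N e \in unitmx.
Proof.
rewrite /edge_iso; case: ifP => [_|/negbT eT]; first exact: unitmx1.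
by have [] := pi1_t_inverse eT.
Qed.

Section Line.
Variables (X0 Z : qrep F alpha).
Hypothesis X0N : forall e, edge_mx N X0 e = edge_iso N e.

Let X t := X0 + t *: Z.

Lemma line_start : X 0 = X0.
Proof. by rewrite /X scale0r addr0. Qed.

Lemma edge_mx_regular e : mregular (fun t => edge_mx N (X t) e).
Proof.
rewrite /edge_mx; apply: mregular_sum => a _; apply: mregular_sum => y _; apply: mregular_sum => x _.
apply: mregularZ; last exact: mregular_const.
rewrite /edge_coef.
have -> : (fun t => X t (Tagged (@edge_arrow F S) a : qa (zariski_quiver S)) y x) =
    (fun t => X0 (Tagged (@edge_arrow F S) a : qa (zariski_quiver S)) y x +
      t * Z (Tagged (@edge_arrow F S) a : qa (zariski_quiver S)) y x).
  by apply/funext=> t; rewrite /X qrepDE qrepZE !mxE.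
apply: regularD; first exact: regular_const.
by apply: regularM; [apply: regular_id | apply: regular_const].
Qed.

Variable g : g_V S -> F -> 'M[F]_n.
Hypotheses (g_reg : forall v, mregular (g v)) (g0 : forall v, g v 0 = 1%:M).

(** Every element of the fundamental algebra acts on the representations of the
    family by a matrix of regular functions of t, because the generators do. *)
Lemma action_regular p : exists B : F -> 'M[F]_n, [/\ mregular B, B 0 = N p &
  forall t (h : {lrmorphism P -> 'M[F]_n}), twists (X t) (g^~ t) h -> h p = B t].
Proof.
pose R p := exists B : F -> 'M[F]_n, [/\ mregular B, B 0 = N p &
  forall t (h : {lrmorphism P -> 'M[F]_n}), twists (X t) (g^~ t) h -> h p = B t].
apply/asboolP; change (p \in [pred p | `[< R p >]]).
have edge_reg e : mregular (fun t => twisted_edge (X t) (g^~ t) e).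
  apply: mregularM => //; apply: mregularM; last exact: edge_mx_regular.
  by apply: mregularV; rewrite ?g0 ?unitmx1.
have edge0 e : twisted_edge (X 0) (g^~ 0) e = edge_iso N e.
  by rewrite /twisted_edge !g0 invmx1 mul1mx mulmx1 line_start X0N.
apply: (pi1_generated treeT) => [|v s|e eT].
- split.
  + apply/asboolP; exists (fun=> 1%:M); split=> [||t h _]; rewrite ?rmorph1 //.
    exact: mregular_const.
  + move=> c x y /asboolP[B [B_reg B0 BE]] /asboolP[C [C_reg C0 CE]]; apply/asboolP.
    exists (fun t => c *: B t + C t); split=> [||t h ht].
    * apply: mregularD => //; apply: mregularZ => //; exact: regular_const.
    * by rewrite linearP B0 C0.
    * by rewrite -(BE t h ht) -(CE t h ht) linearP.
  + move=> x y /asboolP[B [B_reg B0 BE]] /asboolP[C [C_reg C0 CE]]; apply/asboolP.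
    exists (fun t => B t *m C t); split=> [||t h ht].
    * exact: mregularM.
    * by rewrite rmorphM B0 C0.
    * by rewrite -(BE t h ht) -(CE t h ht) rmorphM.
- apply/asboolP; exists (fun t => invmx (g v t) *m N (pi1_incl P v s) *m g v t).
  split=> [||t h [hS _]]; last exact: hS.
    apply: mregularM => //; apply: mregularM; last exact: mregular_const.
    by apply: mregularV; rewrite ?g0 ?unitmx1.
  by rewrite !g0 invmx1 mul1mx mulmx1.
have [tU tV] := pi1_t_inverse eT.
have edge0' : twisted_edge (X 0) (g^~ 0) e = N (pi1_tinv P e).
  by rewrite edge0 /edge_iso (negPf eT).
split; apply/asboolP.
  exists (fun t => invmx (twisted_edge (X t) (g^~ t) e)); split=> [||t h [_ /(_ e eT)[]]] //.
    by apply: mregularV => //; rewrite edge0'.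
  by rewrite edge0' tV.
by exists (fun t => twisted_edge (X t) (g^~ t) e); split=> // t h [_ /(_ e eT)[]].
Qed.

(** Elements p_r that act by the matrix units for t = 0 act by a basis of the
    matrices for almost all t. *)
Lemma family_surjective : simple_rep N -> generic (fun t =>
  forall h : {lrmorphism P -> 'M[F]_n}, twists (X t) (g^~ t) h -> forall A, exists p, h p = A).
Proof.
move=> simN.
have [p pE] := choice (fun r => simple_surjective simN (vec_mx (delta_mx 0 r))).
have [B BE] := choice (fun r => action_regular (p r)).
pose K t : 'M[F]_(n * n) := \matrix_r mxvec (B r t).
have K_reg : mregular K.
  move=> r s; case/mxvec_indexP: s => i j; have [B_reg _ _] := BE r.
  have -> : (fun t => K t r (mxvec_index i j)) = (fun t => B r t i j).
    by apply/funext=> t; rewrite mxE mxvecE.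
  exact: B_reg.
have K0 : K 0 = 1%:M.
  apply/row_matrixP=> r; rewrite rowK row1; have [_ -> _] := BE r.
  by rewrite pE vec_mxK.
have : generic (fun t => K t \in unitmx) by apply: mregular_unit; rewrite ?K0 ?unitmx1.
apply: generic_sub => t KU h ht A.
pose c := mxvec A *m invmx (K t).
have cK : mxvec A = c *m K t by rewrite mulmxKV.
exists (\sum_r c 0 r *: p r); apply: (can_inj mxvecK); rewrite cK mulmx_sum_row !linear_sum.
apply: eq_bigr => r _; rewrite rowK !linearZ /=; congr (_ *: mxvec _).
by have [_ _ /(_ t h ht)] := BE r.
Qed.

End Line.

End Deformation.

(** On the line from the point of a simple representation to an arbitrary point,
    all but finitely many points are simple. *)
Lemma simple_locus_dense (F : closedFieldType) (S : separable_graph F) (T : {set g_E S})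
    (P : fundamental_algebra T) (alpha : dimvec (zariski_quiver S))
    (N : pi1_rep P alpha) (q : {mpoly F[#|coord_index alpha|]}) :
  maximal_subtree T -> simple_rep N -> q != 0 ->
  exists X, q.@[qcoord X] != 0 /\ simple_locus P X.
Proof.
move=> treeT simN /mpoly_nonzero_point[x1 qx1].
have [X0 X0N] := quiver_point_exists treeT N.
pose Z : qrep F alpha := qrep_of (fun r => x1 r - qcoord X0 r).
have [D DE] := mpoly_line q (qcoord X0) (qcoord Z).
have q_generic : generic (fun t => q.@[qcoord (X0 + t *: Z)] != 0).
  exists D => [|t].
    apply: contraNneq qx1 => D0; have := DE 1; rewrite D0 horner0 => ->.
    by apply/eqP/meval_eq=> r; rewrite qrep_ofE mul1r addrCA subrr addr0.
  rewrite DE; congr (_ != 0); apply: meval_eq => r.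
  by rewrite qcoordD qcoordZ.
have edge_reg e : mregular (fun t => edge_mx N (X0 + t *: Z) e) by apply: edge_mx_regular.
have edge0 e : edge_mx N (X0 + 0 *: Z) e = edge_iso N e.
  by rewrite scale0r addr0 X0N.
have [|g [g_reg g0 gE]] := potentials (tree_grown P treeT) edge_reg.
  by move=> e eT; rewrite edge0 /edge_iso eT.
have edge_generic : generic (fun t => forall e, edge_mx N (X0 + t *: Z) e \in unitmx).
  by apply: generic_all => e; apply: mregular_unit; rewrite ?edge0 ?edge_iso_unit.
have [t [qt [XU surj]]] := generic_ex (genericI q_generic
  (genericI edge_generic (family_surjective treeT Z X0N g_reg g0 simN))).
have [gU gT] := gE t XU.
have [h ht] := twists_exist treeT (g := g^~ t) gU XU gT simN.1.
have [N' N'X simN'] := twists_point gU gT ht.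
exists (X0 + t *: Z); split=> //; exists N' => //; apply: simN'.
by apply: surjective_simple; [exact: simN.1 | exact: surj].
Qed.

Theorem proposition11 (F : closedFieldType) (charF : [pchar F] =i pred0)
    (S : separable_graph F) (connS : connected_graph S)
    (T : {set g_E S}) (treeT : maximal_subtree T) (P : fundamental_algebra T)
    (k : nat) (alphas : 'I_k -> dimvec (zariski_quiver S))
    (alphasP : minimal_generators (@semistable_dimvec F S) alphas)
    (c : dimvec (one_quiver alphas)) (alpha : dimvec (zariski_quiver S))
    (alphaE : alpha = \sum_(i < k) alphas i *+ c i)
    (alpha_simple : exists N : pi1_rep P alpha, simple_rep N)
    (SS : forall i, pi1_rep P (alphas i))
    (SS_simple : forall i, simple_rep (SS i))
    (N : pi1_rep P alpha)
    (D : decomposition N (fun i => SS i : P -> 'M[F]_(pr_dim (SS i))) c)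
    (M : qrep F alpha) (NM : quiver_point N M)
    (iota : {linear qrep F c -> qrep F alpha})
    (iotaP : normal_identification D M iota) :
  exists U : qrep F alpha -> Prop,
    [/\ zariski_open U,
        exists X, U X /\ simple_locus P X
      & forall X, U X -> simple_locus P X ->
          GL_saturation (normal_slice M iota) X].
Proof.
have transversal (Y : qrep F alpha) : exists h V, Y = defect M M h + iota V.
  have [Z [V [tanZ ->]]] := ni_tangentD iotaP Y.
  by have [h ->] := tangent_infinitesimal tanZ; exists h, V.
have [q q0 slice_q] := saturated_slice_open transversal.
exists (fun X => q.@[qcoord X] != 0); split.
- exists (fun p => p = q) => X; split=> [qX|[p -> //]].
  by exists q.
- by have [N1 simN1] := alpha_simple; apply: simple_locus_dense treeT simN1 q0.
move=> X /slice_q[g [V [gU ->]]] _; exists g, (M + iota V); split=> //.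
by exists V.
Qed.
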